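(* Let $F$ be a C-function with $F(\beta_0)=1$ and $\mathfrak{L}_F$ positive definite, and let $N,r\ge0$. For all $n\ge0$ let $\phi_{N+n}\in\mathcal{L}_{N+n}\setminus\{0\}$ with $\phi_{N+n}\perp_F\mathcal{L}_{N+n-1}$, let $\psi_{N+n}$ be the rational function of the second kind of $\phi_{N+n}$, and let $\lambda_{N+n}\in\mathbb{D}$ and $u_{N+n}$ ($n>0$) be the coefficients in their recurrence relation $$\begin{pmatrix}\phi_{N+n}&\psi_{N+n}\\ \phi_{N+n}^*&-\psi_{N+n}^*\end{pmatrix}=u_{N+n}\begin{pmatrix}1&\overline{\lambda_{N+n}}\\ \lambda_{N+n}&1\end{pmatrix}\begin{pmatrix}\zeta_{N+n-1}&0\\0&1\end{pmatrix}\begin{pmatrix}\phi_{N+n-1}&\psi_{N+n-1}\\ \phi_{N+n-1}^*&-\psi_{N+n-1}^*\end{pmatrix}.$$ Suppose $A,B,C,D\in\mathcal{L}_N\cdot\tilde{\mathcal{L}}_r$ are self-reciprocal rational functions satisfying: $$\tau_A:=\frac{A^*(z)}{A(z)}=-\frac{B^*(z)}{B(z)}=-\frac{C^*(z)}{C(z)}=\frac{D^*(z)}{D(z)},\qquad \tau_A\in\mathbb{T};$$ $B(\beta_j)\neq0$ for $j=0,\ldots,N-1$ if $N>0$; $(A-BF)(z)=\zeta_0(z)B_{N-1}(z)g(z)$ with $g\in H(\mathbb{D})$; and $(AD-BC)(z)=\zeta_0(z)B_{N-1}(z)f(z)$ with $f\in H(\mathbb{D})$. Let $c_n\in\mathbb{R}\setminus\{0\}$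 $(n\ge 0)$ and define, for $n\ge0$, $$G_{r+n}=\frac{\phi_{N+n}A+\psi_{N+n}B}{c_nP_NB_N},\qquad J_{r+n}=\frac{\phi_{N+n}C+\psi_{N+n}D}{c_nP_NB_N}.$$ Then $G_{r+n}$ and $J_{r+n}$ satisfy, for $n>0$, the recurrence relation $$\begin{pmatrix}G_{r+n}&J_{r+n}\\ G_{r+n}^*&-J_{r+n}^*\end{pmatrix}=v_{r+n}\begin{pmatrix}1&\overline{\gamma_{r+n}}\\ \gamma_{r+n}&1\end{pmatrix}\begin{pmatrix}\tilde\zeta_{r+n-1}&0\\0&1\end{pmatrix}\begin{pmatrix}G_{r+n-1}&J_{r+n-1}\\ G_{r+n-1}^*&-J_{r+n-1}^*\end{pmatrix},$$ where $\gamma_{r+n}=\overline{\tau_A}\,\lambda_{N+n}$, $v_{r+n}(z)=\dfrac{c_{n-1}}{c_n}u_{N+n}(z)$, $\tilde\zeta_{r+n-1}(z)=\zeta_{N+n-1}(z)=\hat\zeta_{n-1}(z)$, and with initial conditions $G_r,J_r\in\tilde{\mathcal{L}}_r$.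
   Context: Notation. $\mathbb{T}$ and $\mathbb{D}$ are the complex unit circle and open unit disc; $H(\mathbb{D})$ is the set of holomorphic functions on $\mathbb{D}$. The substar conjugate is $f_*(z)=\overline{f(1/\overline z)}$. For any sequence of points $\beta_0,\beta_1,\ldots$ in $\mathbb{D}$ put $\varpi_k(z)=1-\overline{\beta_k}z$, $\varpi_k^*(z)=z-\beta_k$, $\eta_k=\overline{\beta_k}/|\beta_k|$ if $\beta_k\neq0$ and $\eta_k=1$ if $\beta_k=0$, $\zeta_k=\eta_k\varpi_k^*/\varpi_k$, $B_{-1}=1/\zeta_0$, and $B_k=B_{k-1}\zeta_k$ for $k\ge0$ (so $B_0=1$). The associated spaces are $\mathcal{L}_{-1}=\{0\}$, $\mathcal{L}_0=\mathbb{C}$, $\mathcal{L}_k=\mathcal{L}\{\beta_1,\ldots,\beta_k\}=\{p/(\varpi_1\cdots\varpi_k): p \text{ a polynomial of degree}\le k\}$, and $\mathcal{L}=\bigcup_k\mathcal{L}_k$. Three families of points in $\mathbb{D}$ are given: $\beta_0,\ldots,\beta_N$; $\hat\beta_0,\hat\beta_1,\hat\beta_2,\ldots$ with $\hat\beta_0=\beta_N$; and $\tilde\beta_0,\ldots,\tilde\beta_r$. Hats and tildes over $\zeta,B,\mathcal{L}$ mean that these are built from the corresponding family (except that $\tilde\zeta_{r+n-1}$, $n>0$, in the claim is defined there). The first family is continued by $\beta_{N+j}:=\hat\beta_j$ ($j\ge1$), so that $\zeta_{N+j}=\hat\zeta_j$, $B_{N+n}=B_N\hat B_n$, $\mathcal{L}_{N+n}=\mathcal{L}\{\beta_1,\ldots,\beta_N,\hat\beta_1,\ldots,\hat\beta_n\}$;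 $\mathcal{L}_{N+n-1}=\mathcal{L}_N\cdot\hat{\mathcal{L}}_{n-1}$ if $n>0$, $=\mathcal{L}_{N-1}$ if $n=0$. Likewise $\tilde{\mathcal{L}}_{r+n}=\mathcal{L}\{\tilde\beta_1,\ldots,\tilde\beta_r,\hat\beta_1,\ldots,\hat\beta_n\}=\tilde{\mathcal{L}}_r\cdot\hat{\mathcal{L}}_n$. Superstar: for a function $f$ regarded as an element of one of these spaces, $f^*=\mathbf{B}f_*$ where $\mathbf B=B_{N+n}$ for $\mathcal{L}_{N+n}$, $\mathbf B=B_N\tilde B_r$ for $\mathcal{L}_N\cdot\tilde{\mathcal{L}}_r$, $\mathbf B=\tilde B_r\hat B_n$ for $\tilde{\mathcal{L}}_{r+n}$ (under the stated hypotheses $G_{r+n},J_{r+n}\in\tilde{\mathcal L}_{r+n}$). Self-reciprocal means $f^*=kf$ for some constant $k\in\mathbb{C}$. A C-function is an $F\in H(\mathbb{D})$ with $\Re F(z)>0$ on $\mathbb{D}$. Put $D_0(t,z)=\dfrac{\zeta_0(t)+\zeta_0(z)}{\zeta_0(t)-\zeta_0(z)}$. To a C-function $F$ with $F(\beta_0)=1$ corresponds the probability measure $\mu$ on $\mathbb{T}$ with $F(z)=\int_{\mathbb{T}}D_0(t,z)\,d\mu(t)$, and $\mathfrak{L}_F\{f\}=\int_{\mathbb{T}}f\,d\mu$; positive definite means $\mathfrak{L}_F\{ff_*\}>0$ for all $f\in\mathcal{L}\setminus\{0\}$. $f\perp_Fg$ means $\mathfrak{L}_F\{fg_*\}=0$.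 The function of the second kind of $\phi_k$ is $\psi_k(z)=\mathfrak{L}_F\{D_0(t,z)[\phi_k(t)-\phi_k(z)]\}+\mathfrak{L}_F\{\phi_k(t)\}$. Orthogonal rational functions and their functions of the second kind satisfy the displayed recurrence with $\lambda_k\in\mathbb{D}$ and the $2\times2$ diagonal matrix $u_k(z)=e_k\begin{pmatrix}\rho_k&0\\0&\overline{\rho_k}\,\overline{\eta_{k-1}}\eta_k\end{pmatrix}\dfrac{\varpi_{k-1}(z)}{\varpi_k(z)}$, $|\rho_k|=1$, $e_k\in\mathbb{R}\setminus\{0\}$. $P_N(z)=\dfrac{\varpi_N(\beta_N)\,\varpi_0(z)\varpi_0^*(z)}{\varpi_0(\beta_0)\,\varpi_N(z)\varpi_N^*(z)}$.
   Formalization: The recurrence is proved with γ_{r+n} = τ_A λ_{N+n} in place of the printed conj(τ_A) λ_{N+n}, which is false in general (e.g. N=r=0, all β=0, F=1+z, λ_1=-1/2, constants A=D=w, B=C=iw with τ_A=i); the two agree when τ_A is real. *)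

(* Defs.v *)
From HB Require Import structures.
From mathcomp Require Import all_boot all_order all_algebra.
From mathcomp Require Import fraction generic_quotient complex.
From mathcomp Require Import all_classical all_reals all_analysis.

Set Implicit Arguments.
Unset Strict Implicit.
Unset Printing Implicit Defensive.
Import Order.TTheory GRing.Theory Num.Theory.
Import numFieldNormedType.Exports.
Local Open Scope quotient_scope.
Local Open Scope classical_set_scope.
Local Open Scope ring_scope.

(* Rational functions are elements of the field C(z), so that an equality
   between them ignores removable singularities. *)
Notation ratfun R := {fraction {poly R[i]}}.

(* The complex plane with its Borel sigma-algebra; R[i]^o is the copy of R[i]
   that carries the topology of the complex modulus. *)
Notation borelC R := (g_sigma_algebraType (@open R[i]^o)).

Section Defs.
Variable R : realType.
Local Notation C := R[i].
Local Notation rat := (ratfun R).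

Definition ratcst (a : C) : rat := tofrac (a%:P).

(* A representative numerator and (nonzero) denominator; not always coprime. *)
Definition numer (f : rat) : {poly C} := (frac (repr f)).1.
Definition denom (f : rat) : {poly C} := (frac (repr f)).2.

(* Value at z, after cancelling common factors; it is 0 at a pole. *)
Definition feval (f : rat) (z : C) : C :=
  let p := numer f in let q := denom f in
  (p %/ gcdp p q).[z] / (q %/ gcdp p q).[z].

(* f_*(z) = conj (f (1 / conj z)): conjugate the coefficients, replace z by
   1/z. *)
Definition substar_poly (p : {poly C}) : rat :=
  (map_poly (fun a => ratcst (conjc a)) p).[(tofrac 'X)^-1].
Definition substar (f : rat) : rat :=
  substar_poly (numer f) / substar_poly (denom f).

Definition superstar (Bf f : rat) : rat := Bf * substar f.

Definition self_reciprocal (Bf f : rat) : Prop :=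
  exists k : C, superstar Bf f = ratcst k * f.

Definition varpi_poly (b : C) : {poly C} := 1 - conjc b *: 'X.
Definition varpi (b : C) : rat := tofrac (varpi_poly b).
Definition varpi_star (b : C) : rat := tofrac ('X - b%:P).
Definition eta_at (b : C) : C := if b == 0 then 1 else conjc b / `|b|.
Definition zeta (b : C) : rat := ratcst (eta_at b) * varpi_star b / varpi b.

(* Index shifted by one: [Bpred beta k] is B_{k-1}, starting from
   B_{-1} = 1 / zeta_0. *)
Fixpoint Bpred (beta : nat -> C) (k : nat) : rat :=
  if k is k'.+1 then Bpred beta k' * zeta (beta k') else (zeta (beta 0%N))^-1.
Definition Bl (beta : nat -> C) (k : nat) : rat := Bpred beta k.+1.

(* The space L{b_1, ..., b_k} of all p / (varpi_1 ... varpi_k), deg p <= k. *)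
Definition ratspace_seq (s : seq C) (f : rat) : Prop :=
  exists2 p : {poly C}, (size p <= (size s).+1)%N
    & f = tofrac p / \prod_(b <- s) varpi b.

(* beta_1, ..., beta_k; in particular beta_0 is not used. *)
Definition points (beta : nat -> C) (k : nat) : seq C :=
  [seq beta j | j <- iota 1 k].
Definition ratspace (beta : nat -> C) (k : nat) : rat -> Prop :=
  ratspace_seq (points beta k).
(* [ratspace_pred beta k] is L_{k-1}, with L_{-1} = {0}. *)
Definition ratspace_pred (beta : nat -> C) (k : nat) (f : rat) : Prop :=
  if k is k'.+1 then ratspace beta k' f else f = 0.

(* L_N . Lt_r = L{beta_1, ..., beta_N, betat_1, ..., betat_r}. *)
Definition ratspace_mul (beta : nat -> C) (N : nat) (betat : nat -> C) (r : nat) :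
    rat -> Prop :=
  ratspace_seq (points beta N ++ points betat r).

(* The family beta_0, ..., beta_N continued by beta_{N+j} := betah_j. *)
Definition continued (N : nat) (beta betah : nat -> C) (k : nat) : C :=
  if (k <= N)%N then beta k else betah (k - N)%N.

Definition holomorphic_disc (f : C -> C) : Prop :=
  forall z : C, `|z| < 1 -> derivable (f : C^o -> C^o) (z : C^o) 1.

Definition C_function (F : C -> C) : Prop :=
  holomorphic_disc F /\ forall z : C, `|z| < 1 -> 0 < complex.Re (F z).

Definition unit_circle : set C := [set t | `|t| = 1].

(* A probability measure on the circle is a Borel probability on the plane
   that gives the circle mass 1. *)
Definition on_circle (mu : probability (borelC R) R) : Prop :=
  mu (unit_circle : set (borelC R)) = 1%E.

Definition cintegral (mu : probability (borelC R) R) (f : C -> C) : C :=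
  Complex (\int[mu]_(t in unit_circle) complex.Re (f t))
          (\int[mu]_(t in unit_circle) complex.Im (f t)).

Definition kerD (b0 t z : C) : C :=
  (feval (zeta b0) t + feval (zeta b0) z)
  / (feval (zeta b0) t - feval (zeta b0) z).

(* mu is the Herglotz measure of F with respect to the point b0. *)
Definition represents (mu : probability (borelC R) R) (b0 : C) (F : C -> C) :
    Prop :=
  on_circle mu /\
  forall z : C, `|z| < 1 -> F z = cintegral mu (fun t => kerD b0 t z).

Definition LF (mu : probability (borelC R) R) (f : rat) : C :=
  cintegral mu (feval f).

(* The order of R[i] makes [0 < _] mean "real and positive". *)
Definition positive_definite (mu : probability (borelC R) R)
    (beta : nat -> C) : Prop :=
  forall (k : nat) (f : rat), ratspace beta k f -> f != 0 ->
    0 < LF mu (f * substar f).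

Definition orthogonal_LF (mu : probability (borelC R) R) (f g : rat) : Prop :=
  LF mu (f * substar g) = 0.

(* psi is the rational function given by the defining integral; the values in
   the disc determine it, and there the kernel kerD has no singularity. *)
Definition second_kind (mu : probability (borelC R) R) (b0 : C)
    (phi psi : rat) : Prop :=
  forall z : C, `|z| < 1 ->
    feval psi z =
      cintegral mu (fun t => kerD b0 t z * (feval phi t - feval phi z))
      + LF mu phi.

Definition mat2 (a b c d : rat) : 'M[rat]_2 :=
  \matrix_(i < 2, j < 2)
    if i == 0 then (if j == 0 then a else b) else (if j == 0 then c else d).

(* Only for k > 0: [beta k.-1] stands for beta_{k-1}. *)
Definition umx (beta : nat -> C) (k : nat) (e : R) (rho : C) : 'M[rat]_2 :=
  (ratcst (real_complex R e) * varpi (beta k.-1) / varpi (beta k)) *: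
    mat2 (ratcst rho) 0
         0 (ratcst (conjc rho * conjc (eta_at (beta k.-1)) * eta_at (beta k))).

Definition szego_mx (l : C) : 'M[rat]_2 := mat2 1 (ratcst (conjc l)) (ratcst l) 1.

Definition zeta_mx (b : C) : 'M[rat]_2 := mat2 (zeta b) 0 0 1.

(* Rows [f, g] and [f^*, - g^*], the superstars being taken with Bf. *)
Definition pair_mx (Bf f g : rat) : 'M[rat]_2 :=
  mat2 f g (superstar Bf f) (- superstar Bf g).

Definition PN (b0 bN : C) : rat :=
  ratcst ((varpi_poly bN).[bN] / (varpi_poly b0).[b0])
  * (varpi b0 * varpi_star b0) / (varpi bN * varpi_star bN).

End Defs.

(* Main.v *)
Require Import Defs.
From HB Require Import structures.
From mathcomp Require Import all_boot all_order all_algebra.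
From mathcomp Require Import fraction generic_quotient complex.
From mathcomp Require Import all_classical all_reals all_analysis.
From mathcomp Require Import measurable_realfun ring lra zify.
Set Implicit Arguments.
Unset Strict Implicit.
Unset Printing Implicit Defensive.
Import Order.TTheory GRing.Theory Num.Theory.
Import numFieldNormedType.Exports.
Local Open Scope ring_scope.

(** The recurrence is a matter of matrix algebra. The superstar of G = (phi A + psi B) /
    (c_n P_N B_N) is computed from (P_N)_* = P_N, (B_N)_* = 1 / B_N and the eigenvalue
    equations A^* = tau A, B^* = - tau B: it is tau (phi^* A - psi^* B) / (c_n P_N B_N),
    and likewise for J with C, D. So the matrix of G, J and their superstars is
    diag(1, tau) M_n X / (c_n P_N B_N), where M_n is the matrix of phi, psi and
    X = (A, C; B, D) does not depend on n ([pair_mx_transform]). Passing diag(1, tau)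
    through the transfer matrix of M_n replaces lambda by tau lambda
    ([szego_mx_twist], [recurrence_transform]).

    The initial conditions are where the measure enters. Write pi for the product of
    varpi_1, ..., varpi_N, phi_N = p / pi, psi_N = q / pi, and let a, b be the
    numerators of A, B. Up to a constant P_N B_N is omega omega' / pi^2, where omega is
    the product of the z - beta_j and omega' that of the varpi_j, for j < N ([PN_BlE]).
    Therefore G_r lies in the required space as soon as omega omega' divides p a + q b,
    a polynomial of degree at most 2N + r. Divisibility by omega' is divisibility by
    omega of the reversed polynomial, which by self-reciprocity is
    p^ a - q^ b up to a constant, p^ and q^ being the reversals ([pencil_factorization]).

    Since p a + q b = b (p F + q) + p (a - b F), and since a - b F has the zeros of
    omega by hypothesis, it remains to see that p F + q and p^ F - q^ have
    them too. The integral formula of the function of the second kind gives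
    p F + q = pi(z) times the integral of D_0(t, z) phi(t), and D_0(t, z) is
    1 + const (z - beta_0) (1 - conj(beta_0) t) / (t - z). Orthogonality to constants
    removes the term 1, and orthogonality to the rest of the space extracts the other
    factors of omega from the Cauchy kernel ([cauchy_divisible]). The same formula at
    1/conj z, which holds since q is obtained by coefficientwise integration
    ([second_kind_poly]), gives p^ F - q^ with all of its zeros in evidence
    ([reversed_remainder]). For C, D one uses
    b (p c + q d) = d (p a + q b) - p (a d - b c) and that b does not vanish at the zeros
    of omega ([dvdp_pencil_dual]).

    Zeros are counted by local bounds instead of power series: a polynomial that is
    O(omega) near each root of omega is divisible by omega ([dvdp_dominated]). Hence the
    integrals depending on z need only be bounded locally, not holomorphic. *)

(** * The substar conjugate is a field morphism *)

(** The identity zeta_* = 1 / zeta with eta, conj eta, varpi and varpi^* replaced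
    by generic field elements. *)
Lemma inv_blaschke (K : fieldType) (x e e' v w : K) : x != 0 -> v != 0 -> w != 0 ->
  e' * e = 1 -> e' * (v / x) / (w / x) = (e * w / v)^-1.
Proof.
move=> x0 v0 w0 h; have e0 : e != 0.
  by apply: contra_eq_neq h => ->; rewrite mulr0 eq_sym oner_neq0.
have -> : e' = e^-1 by apply: (mulIf e0); rewrite h mulVf.
by field; rewrite x0 v0 w0 e0.
Qed.

(** The powers of z produced by the substar of varpi_0 varpi_0^* and of
    varpi_N varpi_N^* cancel; this is why P_N is its own substar. *)
Lemma cancel_double_div (K : fieldType) (x c a b d e : K) : x != 0 -> d != 0 -> e != 0 ->
  c * (a / x * (b / x)) / (d / x * (e / x)) = c * (b * a) / (e * d).
Proof. by move=> x0 d0 e0; field; rewrite x0 d0 e0. Qed.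

Section Substar.
Variable R : realType.
Local Notation C := R[i].
Local Notation rat := (ratfun R).
Local Notation cst := (@ratcst R).
Implicit Types (f g : rat) (p q : {poly C}).

Lemma ratcst_is_zmod : zmod_morphism cst.
Proof. by move=> a b; rewrite /ratcst !rmorphB. Qed.
Lemma ratcst_is_monoid : monoid_morphism cst.
Proof. by split=> [|a b]; rewrite /ratcst ?rmorph1 ?rmorphM. Qed.
HB.instance Definition _ := GRing.isZmodMorphism.Build C rat cst ratcst_is_zmod.
HB.instance Definition _ := GRing.isMonoidMorphism.Build C rat cst ratcst_is_monoid.

Lemma ratcstM a b : cst (a * b) = cst a * cst b. Proof. exact: rmorphM. Qed.
Lemma ratcstN a : cst (- a) = - cst a. Proof. exact: rmorphN. Qed.
Lemma ratcstV a : cst a^-1 = (cst a)^-1. Proof. exact: fmorphV. Qed.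

(** Named so that the coefficient map inside substar_poly is visibly a ring
    morphism; multiplicativity of the substar then comes from map_poly. *)
Definition conj_cst (a : C) : rat := cst (conjc a).

Lemma conj_cst_zmod : zmod_morphism conj_cst.
Proof. by move=> a b; rewrite /conj_cst /ratcst !rmorphB. Qed.
Lemma conj_cst_monoid : monoid_morphism conj_cst.
Proof. by split=> [|a b]; rewrite /conj_cst /ratcst ?rmorph1 ?rmorphM. Qed.
HB.instance Definition _ := GRing.isZmodMorphism.Build C rat conj_cst conj_cst_zmod.
HB.instance Definition _ := GRing.isMonoidMorphism.Build C rat conj_cst conj_cst_monoid.

Lemma substar_polyE p : substar_poly p = (map_poly conj_cst p).[(tofrac 'X)^-1].
Proof. by []. Qed.

Lemma substar_polyB : zmod_morphism (@substar_poly R).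
Proof. by move=> p q; rewrite !substar_polyE rmorphB hornerD hornerN. Qed.
Lemma substar_polyM : monoid_morphism (@substar_poly R).
Proof.
by split=> [|p q]; rewrite !substar_polyE ?rmorph1 ?hornerC// rmorphM hornerM.
Qed.
HB.instance Definition _ :=
  GRing.isZmodMorphism.Build {poly C} rat (@substar_poly R) substar_polyB.
HB.instance Definition _ :=
  GRing.isMonoidMorphism.Build {poly C} rat (@substar_poly R) substar_polyM.

Lemma substar_polyC a : substar_poly a%:P = cst (conjc a).
Proof. by rewrite substar_polyE map_polyC hornerC. Qed.

Lemma substar_polyX : substar_poly ('X : {poly C}) = (tofrac 'X)^-1.
Proof. by rewrite substar_polyE map_polyX hornerX. Qed.

(** This is z^n p_*(z), for deg p <= n. The degree bound n is a parameter
    because the superstar depends on the space, not only on the function. *)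
Definition reversal n p : {poly C} := \poly_(i < n.+1) conjc p`_(n - i).

Lemma size_reversal n p : (size (reversal n p) <= n.+1)%N.
Proof. exact: size_poly. Qed.

Lemma coef_reversal n p i : (reversal n p)`_i = if (i <= n)%N then conjc p`_(n - i) else 0.
Proof. by rewrite coef_poly ltnS. Qed.

Lemma reversalK n p : (size p <= n.+1)%N -> reversal n (reversal n p) = p.
Proof.
move=> hp; apply/polyP => i; rewrite !coef_reversal leq_subr.
case: leqP => hi; first by rewrite subKn// conjcK.
by rewrite nth_default// (leq_trans hp).
Qed.

Lemma reversal_eq0 n p : (size p <= n.+1)%N -> (reversal n p == 0) = (p == 0).
Proof.
move=> hp; apply/eqP/eqP => [h|->]; last first.
  by apply/polyP => i; rewrite coef_reversal !coef0 conjc0 if_same.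
rewrite -(reversalK hp) h; apply/polyP => i.
by rewrite coef_reversal !coef0 conjc0 if_same.
Qed.

Lemma tofracX_neq0 : (tofrac 'X : rat) != 0.
Proof. by rewrite tofrac_eq0 polyX_eq0. Qed.

Lemma substar_poly_reversal n p : (size p <= n.+1)%N ->
  substar_poly p = tofrac (reversal n p) / tofrac 'X ^+ n.
Proof.
move=> hp; rewrite substar_polyE /reversal poly_def rmorph_sum /= mulr_suml.
rewrite (horner_coef_wide _ (n := n.+1)); last first.
  by apply: leq_trans hp; exact: size_poly.
rewrite (reindex_inj rev_ord_inj) /=; apply: eq_bigr => i _.
have hi : (i <= n)%N by rewrite -ltnS.
rewrite subSS -mul_polyC rmorphM rmorphXn /= coef_map /= -mulrA; congr (_ * _).
apply: (mulIf (expf_neq0 n tofracX_neq0)); rewrite mulfVK ?expf_neq0 ?tofracX_neq0//.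
have -> : tofrac 'X ^+ n = tofrac 'X ^+ (n - i) * tofrac 'X ^+ i :> rat.
  by rewrite -exprD subnK.
by rewrite exprVn mulKf// expf_neq0 ?tofracX_neq0.
Qed.

Lemma substar_poly_eq0 p : (substar_poly p == 0) = (p == 0).
Proof.
rewrite (@substar_poly_reversal (size p)) ?leqnSn// mulf_eq0 tofrac_eq0 reversal_eq0 ?leqnSn//.
by rewrite invr_eq0 expf_eq0 (negPf tofracX_neq0) andbF orbF.
Qed.

Lemma denom_neq0 f : denom f != 0.
Proof. exact: denom_ratioP. Qed.

Lemma numden f : tofrac (numer f) / tofrac (denom f) = f.
Proof.
have key (x : {ratio {poly C}}) :
    (\pi_{fraction {poly C}} x)%qT * tofrac (frac x).2 = tofrac (frac x).1 :> rat.
  unlock tofrac; rewrite -[LHS]FracField.pi_mul; apply/eqmodP.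
  rewrite /= FracField.equivfE /FracField.mulf.
  rewrite !numden_Ratio ?mulf_neq0 ?oner_eq0 ?denom_ratioP//.
  by rewrite !mulr1 mulrC.
apply: (mulIf (_ : tofrac (denom f) != 0)).
  by rewrite tofrac_eq0 denom_neq0.
rewrite mulfVK ?tofrac_eq0 ?denom_neq0//.
by rewrite /numer /denom -key reprK.
Qed.

(** The substar is computed on a representative that need not be coprime;
    it does not depend on it. *)
Lemma substar_frac p q : q != 0 ->
  substar (tofrac p / tofrac q) = substar_poly p / substar_poly q.
Proof.
move=> q0; rewrite /substar; set f := tofrac p / tofrac q.
have d0 := denom_neq0 f.
apply/eqP; rewrite eqr_div ?substar_poly_eq0// -!rmorphM; apply/eqP; congr substar_poly.
apply/eqP; rewrite -tofrac_eq !rmorphM/=; apply/eqP.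
apply/eqP; rewrite -eqr_div ?tofrac_eq0//; apply/eqP; exact: numden.
Qed.

Lemma substar_is_zmod : zmod_morphism (@substar R).
Proof.
move=> f g; rewrite -(numden f) -(numden g).
have [d1 d2] := (denom_neq0 f, denom_neq0 g).
rewrite -mulNr addf_div ?tofrac_eq0// -rmorphN -!rmorphM -rmorphD/=.
rewrite !substar_frac ?mulf_neq0// -mulNr addf_div ?substar_poly_eq0//.
by rewrite rmorphD !rmorphM rmorphN.
Qed.

Lemma substar_is_monoid : monoid_morphism (@substar R).
Proof.
split=> [|f g].
  by have := @substar_frac 1 1 (oner_neq0 _); rewrite !rmorph1 !divr1.
rewrite -(numden f) -(numden g).
have [d1 d2] := (denom_neq0 f, denom_neq0 g).
rewrite mulf_div -!rmorphM !substar_frac ?mulf_neq0//.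
by rewrite [RHS]mulf_div -!rmorphM.
Qed.
HB.instance Definition _ := GRing.isZmodMorphism.Build rat rat (@substar R) substar_is_zmod.
HB.instance Definition _ := GRing.isMonoidMorphism.Build rat rat (@substar R) substar_is_monoid.

Lemma substar_tofrac p : substar (tofrac p) = substar_poly p.
Proof.
by have := @substar_frac p 1 (oner_neq0 _); rewrite !rmorph1 !divr1.
Qed.

Lemma substar_cst a : substar (cst a) = cst (conjc a).
Proof. by rewrite /ratcst substar_tofrac substar_polyC. Qed.

Lemma substar_reversal n p q : (size p <= n.+1)%N -> (size q <= n.+1)%N -> q != 0 ->
  substar (tofrac p / tofrac q) = tofrac (reversal n p) / tofrac (reversal n q).
Proof.
move=> hp hq q0; rewrite substar_frac// !(@substar_poly_reversal n)//.
by rewrite -mulf_div divff ?mulr1// invr_eq0 expf_neq0 ?tofracX_neq0.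
Qed.

Lemma ratcst_eq0 a : (cst a == 0) = (a == 0).
Proof. by rewrite /ratcst tofrac_eq0 polyC_eq0. Qed.

Lemma varpi_poly_neq0 (b : C) : varpi_poly b != 0.
Proof.
apply/negP => /eqP/(congr1 (fun p : {poly C} => p.[0])).
by rewrite /varpi_poly !hornerE subr0 => /eqP; rewrite oner_eq0.
Qed.
Lemma varpi_neq0 (b : C) : varpi b != 0. Proof. by rewrite tofrac_eq0 varpi_poly_neq0. Qed.
Lemma varpi_star_neq0 (b : C) : varpi_star b != 0.
Proof. by rewrite tofrac_eq0 polyXsubC_eq0. Qed.

Lemma norm_eta (b : C) : `|eta_at b| = 1.
Proof.
rewrite /eta_at; case: eqVneq => [_|b0]; first exact: normr1.
by rewrite normrM normfV normr_id normcJ divff// normr_eq0.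
Qed.

Lemma eta_conj (b : C) : conjc (eta_at b) * eta_at b = 1.
Proof. by rewrite mulrC -sqr_normc norm_eta expr1n. Qed.

Lemma eta_neq0 (b : C) : eta_at b != 0.
Proof. by rewrite -normr_eq0 norm_eta oner_eq0. Qed.

Lemma zeta_neq0 (b : C) : zeta b != 0.
Proof. by rewrite !mulf_neq0 ?invr_eq0 ?varpi_neq0 ?varpi_star_neq0 ?ratcst_eq0 ?eta_neq0. Qed.

Lemma varpi_polyE (b : C) : varpi_poly b = 1 - (conjc b)%:P * 'X.
Proof. by rewrite /varpi_poly mul_polyC. Qed.

Lemma substar_varpi (b : C) : substar (varpi b) = varpi_star b / tofrac 'X.
Proof.
rewrite /varpi substar_tofrac varpi_polyE rmorphB rmorph1 rmorphM /= substar_polyC substar_polyX.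
rewrite conjcK /varpi_star rmorphB /= mulrBl divff ?tofracX_neq0//.
Qed.

Lemma substar_varpi_star (b : C) : substar (varpi_star b) = varpi b / tofrac 'X.
Proof.
rewrite /varpi_star substar_tofrac rmorphB /= substar_polyC substar_polyX.
by rewrite /varpi varpi_polyE rmorphB rmorph1 rmorphM /= mulrBl mul1r mulfK ?tofracX_neq0.
Qed.

(** On the circle f_* is the conjugate of f, and zeta_b is unimodular there. *)
Lemma substar_zeta (b : C) : substar (zeta b) = (zeta b)^-1.
Proof.
rewrite /zeta !rmorphM fmorphV /= substar_cst substar_varpi substar_varpi_star.
apply: (@inv_blaschke _ (tofrac 'X) (cst (eta_at b)) (cst (conjc (eta_at b)))
  (varpi b) (varpi_star b) tofracX_neq0 (varpi_neq0 b) (varpi_star_neq0 b)).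
by rewrite -rmorphM/= eta_conj rmorph1.
Qed.

Lemma Bpred_neq0 (be : nat -> C) n : Bpred be n != 0.
Proof. by elim: n => [|n IH] /=; [rewrite invr_eq0 zeta_neq0|rewrite mulf_neq0 ?zeta_neq0]. Qed.

Lemma BlE (be : nat -> C) n : Bl be n = \prod_(0 <= i < n) zeta (be i.+1).
Proof.
elim: n => [|n IH]; first by rewrite big_nil /Bl /= mulVf ?zeta_neq0.
by rewrite big_nat_recr//= -IH.
Qed.

Lemma zeta_BpredE (be : nat -> C) n :
  zeta (be 0%N) * Bpred be n = \prod_(0 <= i < n) zeta (be i).
Proof.
elim: n => [|n IH]; first by rewrite big_nil /= mulfV ?zeta_neq0.
by rewrite big_nat_recr//= mulrA IH.
Qed.

Lemma substar_Bl (be : nat -> C) n : substar (Bl be n) = (Bl be n)^-1.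
Proof.
by rewrite BlE rmorph_prod -prodfV; apply: eq_bigr => i _; exact: substar_zeta.
Qed.

Lemma horner_varpi_real (b : C) : conjc (varpi_poly b).[b] = (varpi_poly b).[b].
Proof.
rewrite /varpi_poly !hornerE rmorphB rmorph1 rmorphM/= conjcK mulrC.
by congr (1 - _); exact: mulrC.
Qed.

Lemma substar_PN (b0 bN : C) : substar (PN b0 bN) = PN b0 bN.
Proof.
rewrite /PN; set k := cst _.
have hk : substar k = k.
  by rewrite /k substar_cst rmorphM fmorphV /= !horner_varpi_real.
rewrite [LHS]rmorphM fmorphV !rmorphM/= hk !substar_varpi_star !substar_varpi.
exact: (@cancel_double_div _ (tofrac 'X) _ _ _ _ _ tofracX_neq0
  (varpi_star_neq0 bN) (varpi_neq0 bN)).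
Qed.

End Substar.

(** * Transformation of the recurrence *)

Lemma mat2E (R : realType) (a b c d a' b' c' d' : ratfun R) :
  mat2 a b c d *m mat2 a' b' c' d' =
  mat2 (a * a' + b * c') (a * b' + b * d') (c * a' + d * c') (c * b' + d * d').
Proof.
apply/matrixP => i j; rewrite !mxE !big_ord_recl big_ord0 addr0 !mxE /=.
by case: (i == 0); case: (j == 0).
Qed.

Lemma mat2Z (R : realType) (k a b c d : ratfun R) :
  k *: mat2 a b c d = mat2 (k * a) (k * b) (k * c) (k * d).
Proof. by apply/matrixP => i j; rewrite !mxE; case: (i == 0); case: (j == 0). Qed.

(** Entries of products with diag(1, t), over an abstract ring: there 0 and 1
    are told apart without unfolding the construction of a field of fractions. *)
Lemma lincomb10 (K : nzRingType) (a c : K) : 1 * a + 0 * c = a.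
Proof. by rewrite mul1r mul0r addr0. Qed.
Lemma lincomb01 (K : nzRingType) (t a c : K) : 0 * a + t * c = t * c.
Proof. by rewrite mul0r add0r. Qed.
Lemma lincomb10r (K : nzRingType) (a c : K) : a * 1 + c * 0 = a.
Proof. by rewrite mulr1 mulr0 addr0. Qed.
Lemma lincomb01r (K : nzRingType) (t a c : K) : a * 0 + c * t = c * t.
Proof. by rewrite mulr0 add0r. Qed.

Lemma diag_mul_mat2 (R : realType) (t a b c d : ratfun R) :
  mat2 1 0 0 t *m mat2 a b c d = mat2 a b (t * c) (t * d).
Proof.
rewrite mat2E; congr mat2;
  [exact: lincomb10|exact: lincomb10|exact: lincomb01|exact: lincomb01].
Qed.

Lemma mat2_mul_diag (R : realType) (t a b c d : ratfun R) :
  mat2 a b c d *m mat2 1 0 0 t = mat2 a (b * t) c (d * t).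
Proof.
rewrite mat2E; congr mat2;
  [exact: lincomb10r|exact: lincomb01r|exact: lincomb10r|exact: lincomb01r].
Qed.

(** The computation of G^*: A_* = tau A / (B_N Bt_r) and B_* = - tau B / (B_N Bt_r)
    by the eigenvalue equations, and (B_N)_* = 1 / B_N moves one factor B_N from
    the denominator to the numerator. *)
Lemma superstar_quotient (K : fieldType) (Bt Bh BN s t f p a b a' b' : K) :
    Bt != 0 -> BN != 0 -> BN * Bt * a' = t * a -> BN * Bt * b' = - (t * b) ->
  Bt * Bh * ((f * a' + p * b') / (s * BN^-1))
  = t * ((BN * Bh) * f * a - (BN * Bh) * p * b) / (s * BN).
Proof.
move=> Bt0 BN0 ha hb; have k0 : BN * Bt != 0 by rewrite mulf_neq0.
have -> : a' = t * a / (BN * Bt) by apply: (mulfI k0); rewrite ha mulrCA mulfV ?mulr1.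
have -> : b' = - (t * b) / (BN * Bt) by apply: (mulfI k0); rewrite hb mulrCA mulfV ?mulr1.
rewrite !invfM invrK; move: (s^-1) => i.
by field; rewrite Bt0 BN0.
Qed.

Lemma inv_change_scale (K : fieldType) (c c' s : K) : c' != 0 ->
  (c * s)^-1 = c' / c * (c' * s)^-1.
Proof. by move=> c0; rewrite !invfM mulrACA mulfV// mul1r. Qed.

(** The transfer matrix U S Z is carried through T: the diagonal factors U, Z
    commute with T, and S becomes its twist S'. *)
Lemma twist_product (K : fieldType) n (T U S S' Z M X : 'M[K]_n) (k k' : K) :
    T *m U = U *m T -> T *m S = S' *m T -> T *m Z = Z *m T ->
  (k * k') *: (T *m (U *m S *m Z *m M) *m X) =
  (k *: U) *m S' *m Z *m (k' *: (T *m M *m X)).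
Proof.
move=> hU hS hZ; rewrite -!scalemxAl -!scalemxAr scalerA; congr (_ *: _).
rewrite !mulmxA hU; congr (_ *m _ *m _).
by rewrite -(mulmxA U T) hS -!mulmxA hZ.
Qed.

Section Recurrence.
Variable R : realType.
Local Notation C := R[i].
Local Notation rat := (ratfun R).
Local Notation cst := (@ratcst R).

Lemma superstarE (Bf f : rat) : superstar Bf f = Bf * substar f. Proof. by []. Qed.

Lemma superstar_transform (Bt Bh BN P A B phi psi : rat) (tau : C) (c : R) :
    Bt != 0 -> BN != 0 -> substar P = P -> substar BN = BN^-1 ->
    superstar (BN * Bt) A = cst tau * A ->
    superstar (BN * Bt) B = - (cst tau * B) ->
  superstar (Bt * Bh) ((phi * A + psi * B) / (cst (real_complex R c) * P * BN)) =
  cst tau * (superstar (BN * Bh) phi * A - superstar (BN * Bh) psi * B)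
    / (cst (real_complex R c) * P * BN).
Proof.
move=> Bt0 BN0 hP hBN hA hB; rewrite !superstarE in hA hB *.
rewrite rmorphM fmorphV rmorphD !rmorphM /= substar_cst conjc_real hP hBN.
exact: (@superstar_quotient _ Bt Bh BN _ _ _ _ _ _ _ _ Bt0 BN0 hA hB).
Qed.

(** The new matrix of functions is diag(1, tau) times the old one times a matrix
    that does not involve n, up to a scalar; this is all that the recurrence
    needs. *)
Lemma pair_mx_transform (Bt Bh BN P A B C' D phi psi : rat) (tau : C) (c : R) :
    let s := cst (real_complex R c) * P * BN in
    Bt != 0 -> BN != 0 -> substar P = P -> substar BN = BN^-1 ->
    superstar (BN * Bt) A = cst tau * A ->
    superstar (BN * Bt) B = - (cst tau * B) ->
    superstar (BN * Bt) C' = - (cst tau * C') ->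
    superstar (BN * Bt) D = cst tau * D ->
  pair_mx (Bt * Bh) ((phi * A + psi * B) / s) ((phi * C' + psi * D) / s) =
  s^-1 *: (mat2 1 0 0 (cst tau) *m pair_mx (BN * Bh) phi psi *m mat2 A C' B D).
Proof.
move=> s Bt0 BN0 hP hBN hA hB hC hD.
have e1 := superstar_transform Bh phi psi c Bt0 BN0 hP hBN hA hB.
have e2 : superstar (Bt * Bh) ((phi * C' + psi * D) / s) =
    - (cst tau * (superstar (BN * Bh) phi * C' - superstar (BN * Bh) psi * D) / s).
  (* C and D satisfy the hypotheses on A and B with - tau in place of tau. *)
  have hC' : superstar (BN * Bt) C' = cst (- tau) * C' by rewrite rmorphN mulNr.
  have hD' : superstar (BN * Bt) D = - (cst (- tau) * D).
    by rewrite rmorphN mulNr opprK.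
  have -> := superstar_transform Bh phi psi c Bt0 BN0 hP hBN hC' hD'.
  by rewrite rmorphN !mulNr.
rewrite /pair_mx e1 e2 -/s diag_mul_mat2 mat2E mat2Z opprK.
move: (superstar _ phi) (superstar _ psi) (cst tau) s^-1 => x y t s'.
by congr mat2; rewrite mulrC//; congr (_ * _); rewrite mulrBr mulrN mulNr !mulrA.
Qed.

(** The entry conj(lambda) is divided by tau, which is to multiply lambda by tau
    because conj(tau) = 1 / tau. *)
Lemma szego_mx_twist (tau l : C) : `|tau| = 1 ->
  mat2 1 0 0 (cst tau) *m szego_mx l = szego_mx (tau * l) *m mat2 1 0 0 (cst tau).
Proof.
move=> ht; rewrite /szego_mx [LHS]diag_mul_mat2 [RHS]mat2_mul_diag; congr mat2.
- rewrite -rmorphM; congr cst.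
  by rewrite rmorphM /= mulrAC [_ * tau]mulrC -sqr_normc ht expr1n mul1r.
- by rewrite -rmorphM.
- exact: mulrC.
Qed.

Lemma diag_mx_comm (t a d : rat) :
  mat2 1 0 0 t *m mat2 a 0 0 d = mat2 a 0 0 d *m mat2 1 0 0 t.
Proof.
by rewrite [LHS]diag_mul_mat2 [RHS]mat2_mul_diag; congr mat2;
  [rewrite mul0r|rewrite mulr0|exact: mulrC].
Qed.

Lemma Bl_cat (N : nat) (beta betah : nat -> C) n :
  Bl (continued N beta betah) (N + n) = Bl (continued N beta betah) N * Bl betah n.
Proof.
rewrite !BlE (@big_cat_nat _ _ _ N 0 (N + n)) ?leq_addr//=; congr (_ * _).
rewrite -{1}[N]add0n big_addn addKn; apply: eq_big_nat => i hi.
by rewrite /continued leqNgt ltnS leq_addl /= -addSn addnK.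
Qed.

Lemma umx_diag (be : nat -> C) k e rho :
  exists a d : rat, umx be k e rho = mat2 a 0 0 d.
Proof. by rewrite /umx mat2Z mulr0; do 2!eexists. Qed.

Lemma recurrence_transform (U M M' X : 'M[rat]_2) (b lam tau : C) (c c' : R) (s : rat) :
    `|tau| = 1 -> c' != 0 -> (exists a d : rat, U = mat2 a 0 0 d) ->
    M = U *m szego_mx lam *m zeta_mx b *m M' ->
  (cst (real_complex R c) * s)^-1 *: (mat2 1 0 0 (cst tau) *m M *m X) =
  (cst (real_complex R (c' / c)) *: U) *m szego_mx (tau * lam) *m zeta_mx b
    *m ((cst (real_complex R c') * s)^-1 *: (mat2 1 0 0 (cst tau) *m M' *m X)).
Proof.
move=> ht c0 [a [d ->]] ->.
have -> : (cst (real_complex R c) * s)^-1 =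
    cst (real_complex R (c' / c)) * (cst (real_complex R c') * s)^-1.
  have h : cst (real_complex R c') != 0.
    by rewrite ratcst_eq0 -(rmorph0 (real_complex R)) (inj_eq (@complexI R)).
  rewrite !rmorphM !fmorphV /=; exact: inv_change_scale.
apply: twist_product; [exact: diag_mx_comm| exact: szego_mx_twist|exact: diag_mx_comm].
Qed.

End Recurrence.

(** * Values, reversals and factorization of self-reciprocal pencils *)

Section Evaluation.
Variable R : realType.
Local Notation C := R[i].
Local Notation rat := (ratfun R).
Local Notation cst := (@ratcst R).
Implicit Types (p q : {poly C}) (s : seq C) (b z : C).

(** Cancelling common factors changes no value off the zeros of the given
    denominator, since the reduced denominator divides it. *)
Lemma feval_frac p q z : q.[z] != 0 -> feval (tofrac p / tofrac q) z = p.[z] / q.[z].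
Proof.
move=> qz; rewrite /feval; set f := tofrac p / tofrac q.
have q0 : q != 0 by apply: contraNneq qz => ->; rewrite horner0.
have d0 := denom_neq0 f; set g := gcdp _ _.
have g0 : g != 0 by rewrite gcdp_eq0 (negPf d0) andbF.
have e : numer f * q = p * denom f.
  apply/eqP; rewrite -tofrac_eq !rmorphM/= -eqr_div ?tofrac_eq0//; apply/eqP; exact: numden.
have e' : numer f %/ g * q = p * (denom f %/ g).
  apply: (mulfI g0); rewrite mulrA [g * _]mulrC divpK ?dvdp_gcdl// e.
  by rewrite mulrCA [g * _]mulrC divpK ?dvdp_gcdr.
have hd : denom f %/ g %| q.
  rewrite -(@Gauss_dvdpr _ _ (numer f %/ g)) ?e' ?dvdp_mull//.
  by rewrite coprimep_sym coprimep_div_gcd// d0 orbT.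
have dz : (denom f %/ g).[z] != 0.
  by case/dvdpP: hd qz => h ->; rewrite hornerM mulf_eq0 negb_or => /andP[].
apply/eqP; rewrite eqr_div//; apply/eqP.
by rewrite -!hornerM e'.
Qed.

Definition den_poly s : {poly C} := \prod_(b <- s) varpi_poly b.
(** The reversal of [den_poly s], and the numerator of the Blaschke product of s. *)
Definition zeros_poly s : {poly C} := \prod_(b <- s) ('X - b%:P).
Definition eta_prod s : C := \prod_(b <- s) eta_at b.

Lemma den_neq0 s : den_poly s != 0.
Proof. by rewrite /den_poly prodf_seq_neq0; apply/allP => b _; exact: varpi_poly_neq0. Qed.
Lemma zer_monic s : zeros_poly s \is monic. Proof. exact: monic_prod_XsubC. Qed.
Lemma zer_neq0 s : zeros_poly s != 0. Proof. exact: monic_neq0 (zer_monic s). Qed.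
Lemma size_zer s : size (zeros_poly s) = (size s).+1. Proof. exact: size_prod_XsubC. Qed.
Lemma den_cons b s : den_poly (b :: s) = varpi_poly b * den_poly s. Proof. exact: big_cons. Qed.
Lemma zer_cons b s : zeros_poly (b :: s) = ('X - b%:P) * zeros_poly s. Proof. exact: big_cons. Qed.
Lemma den_cat s s' : den_poly (s ++ s') = den_poly s * den_poly s'. Proof. exact: big_cat. Qed.
Lemma zeros_poly_cat s s' : zeros_poly (s ++ s') = zeros_poly s * zeros_poly s'.
Proof. exact: big_cat. Qed.
Lemma tofrac_den s : tofrac (den_poly s) = \prod_(b <- s) varpi b.
Proof. exact: rmorph_prod. Qed.

Lemma eta_prod_neq0 s : eta_prod s != 0.
Proof. by rewrite /eta_prod prodf_seq_neq0; apply/allP => b _; exact: eta_neq0. Qed.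

Lemma prod_zetaE s :
  \prod_(b <- s) zeta b = tofrac (eta_prod s *: zeros_poly s) / tofrac (den_poly s).
Proof.
rewrite /zeta big_split big_split /= prodfV -mul_polyC rmorphM /= /eta_prod /zeros_poly /den_poly.
by rewrite !rmorph_prod.
Qed.

Lemma size_varpi_poly b : (size (varpi_poly b) <= 2)%N.
Proof.
rewrite varpi_polyE (leq_trans (size_polyD _ _))// geq_max size_poly1 size_polyN /=.
rewrite (leq_trans (size_polyMleq _ _))// size_polyX addn2 /=.
exact: size_polyC_leq1.
Qed.

Lemma size_den s : (size (den_poly s) <= (size s).+1)%N.
Proof.
elim: s => [|b s IH]; first by rewrite /den_poly big_nil size_poly1.
rewrite den_cons (leq_trans (size_polyMleq _ _))//.
have := size_varpi_poly b; move: IH; rewrite /=; lia.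
Qed.

Lemma reversalD n p q : reversal n (p + q) = reversal n p + reversal n q.
Proof.
by apply/polyP => i; rewrite coefD !coef_reversal coefD; case: ifP => // _;
  rewrite ?rmorphD ?addr0.
Qed.

Lemma size_mul_leq_deg m n p q : (size p <= m.+1)%N -> (size q <= n.+1)%N ->
  (size (p * q)%R <= (m + n).+1)%N.
Proof. move=> hp hq; apply: leq_trans (size_polyMleq _ _) _; lia. Qed.

Lemma reversalM m n p q : (size p <= m.+1)%N -> (size q <= n.+1)%N ->
  reversal (m + n) (p * q) = reversal m p * reversal n q.
Proof.
move=> hp hq; have hpq := size_mul_leq_deg hp hq.
apply/eqP; rewrite -tofrac_eq; apply/eqP.
have X0 k : (tofrac 'X : rat) ^+ k != 0 by rewrite expf_neq0 ?tofracX_neq0.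
have : substar_poly (p * q) = substar_poly p * substar_poly q by exact: rmorphM.
rewrite (substar_poly_reversal hpq) (substar_poly_reversal hp) (substar_poly_reversal hq).
rewrite [RHS]mulf_div -exprD -rmorphM /= => /(congr1 (fun x => x * tofrac 'X ^+ (m + n))).
by rewrite !(mulfVK (X0 _)).
Qed.

Lemma reversal_varpi b : reversal 1 (varpi_poly b) = 'X - b%:P.
Proof.
apply/polyP => i; rewrite coef_reversal /varpi_poly !coefB coef1 coefZ !coefX coefC.
case: i => [|[|i]] /=.
- by rewrite mulr1 !sub0r rmorphN /= conjcK.
- by rewrite mulr0 !subr0 conjc1.
- by rewrite subr0.
Qed.

Lemma reversal_den s : reversal (size s) (den_poly s) = zeros_poly s.
Proof.
elim: s => [|b s IH].
  apply/polyP => i; rewrite /den_poly /zeros_poly !big_nil coef_reversal !coef1.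
  by case: i => [|i] //=; exact: conjc1.
have -> : size (b :: s) = (1 + size s)%N by [].
by rewrite den_cons zer_cons reversalM ?size_varpi_poly ?size_den// reversal_varpi IH.
Qed.

Lemma reversal_zer s : reversal (size s) (zeros_poly s) = den_poly s.
Proof. by rewrite -reversal_den reversalK// size_den. Qed.

Lemma horner_reversal n p z : z != 0 -> (size p <= n.+1)%N ->
  (reversal n p).[z] = z ^+ n * conjc p.[(conjc z)^-1].
Proof.
move=> z0 hp; rewrite (horner_coef_wide _ hp) (horner_coef_wide _ (size_reversal n p)).
rewrite rmorph_sum mulr_sumr (reindex_inj rev_ord_inj) /=; apply: eq_bigr => i _.
have hi : (i <= n)%N by rewrite -ltnS.
rewrite subSS coef_reversal leq_subr subKn//.
rewrite rmorphM rmorphXn fmorphV/= conjcK mulrCA; congr (_ * _).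
have -> : z ^+ n = z ^+ (n - i) * z ^+ i by rewrite -exprD subnK.
by rewrite exprVn mulfK// expf_neq0.
Qed.

Lemma superstar_ratspace s p : (size p <= (size s).+1)%N ->
  superstar (\prod_(b <- s) zeta b) (tofrac p / tofrac (den_poly s)) =
  tofrac (eta_prod s *: reversal (size s) p) / tofrac (den_poly s).
Proof.
move=> hp; rewrite superstarE (substar_reversal hp (size_den s) (den_neq0 s)).
rewrite reversal_den prod_zetaE.
rewrite -!mul_polyC !rmorphM /=.
have d0 : tofrac (den_poly s) != 0 by rewrite tofrac_eq0 den_neq0.
have z0 : tofrac (zeros_poly s) != 0 by rewrite tofrac_eq0 zer_neq0.
move: (tofrac (den_poly s)) (tofrac (zeros_poly s)) d0 z0 => x y x0 y0.
rewrite -!mulrA; congr (_ * _); rewrite mulrCA [RHS]mulrC; congr (_ * _).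
by rewrite mulrCA mulfV// mulr1.
Qed.

(** Self-reciprocity of p / (varpi_1 ... varpi_n) as a symmetry of the numerator. *)
Lemma superstar_eigen s p tau : (size p <= (size s).+1)%N ->
    superstar (\prod_(b <- s) zeta b) (tofrac p / tofrac (den_poly s)) =
    cst tau * (tofrac p / tofrac (den_poly s)) ->
  eta_prod s *: reversal (size s) p = tau *: p.
Proof.
move=> hp; rewrite superstar_ratspace// mulrA.
move/(congr1 (fun x => x * tofrac (den_poly s))).
rewrite !mulfVK ?tofrac_eq0 ?den_neq0//.
rewrite /ratcst -rmorphM /= mul_polyC => /eqP; rewrite tofrac_eq => /eqP; exact.
Qed.

Lemma horner_varpi_neq0 b z : `|b| < 1 -> `|z| <= 1 -> (varpi_poly b).[z] != 0.
Proof.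
move=> hb hz; rewrite /varpi_poly !hornerE subr_eq0; apply/eqP => /(congr1 Num.norm).
rewrite normr1 normrM normcJ => /esym/eqP; apply/negP; rewrite lt_eqF//.
by rewrite (le_lt_trans _ hb)// ler_piMr.
Qed.

Definition in_disc s := forall b, b \in s -> `|b| < 1.

Lemma den_horner_neq0 s z : in_disc s -> `|z| <= 1 -> (den_poly s).[z] != 0.
Proof.
move=> hs hz; rewrite /den_poly horner_prod prodf_seq_neq0; apply/allP => b bs /=.
by apply: horner_varpi_neq0 => //; exact: hs.
Qed.

Lemma zer_horner_neq0 s z : in_disc s -> 1 <= `|z| -> (zeros_poly s).[z] != 0.
Proof.
move=> hs hz; rewrite /zeros_poly horner_prod prodf_seq_neq0; apply/allP => b bs /=.
rewrite !hornerE subr_eq0; apply: contraTneq hz => ->.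
by rewrite lt_geF// hs.
Qed.

Lemma coprime_zer s q : (forall b, b \in s -> q.[b] != 0) -> coprimep (zeros_poly s) q.
Proof.
elim: s => [|b s IH] hq; first by rewrite /zeros_poly big_nil coprime1p.
rewrite zer_cons coprimepMl coprimep_sym coprimep_XsubC /root hq ?mem_head//=.
by apply: IH => c cs; apply: hq; rewrite in_cons cs orbT.
Qed.

(** By the eigenvalue equations the reversal of P = p a + q b is, up to a constant,
    p^ a - q^ b, with p^ and q^ the reversals. If the points of s are zeros of both,
    P vanishes at these points and at their reflections 1/conj b, and the degree left is r. Working
    with the reversal instead of the roots 1/conj b covers b = 0, where the
    reflected zero is a drop of degree. *)
Lemma pencil_factorization s r (p q a b : {poly C}) (kappa tau : C) :
    in_disc s -> let N := size s in
    (size p <= N.+1)%N -> (size q <= N.+1)%N ->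
    (size a <= (N + r).+1)%N -> (size b <= (N + r).+1)%N ->
    kappa != 0 ->
    kappa *: reversal (N + r) a = tau *: a -> kappa *: reversal (N + r) b = - tau *: b ->
    zeros_poly s %| p * a + q * b -> zeros_poly s %| reversal N p * a - reversal N q * b ->
  exists2 w : {poly C}, (size w <= r.+1)%N & p * a + q * b = zeros_poly s * den_poly s * w.
Proof.
move=> hs N hp hq ha hb k0 ra rb d1 d2; set m := (N + r)%N in ha hb ra rb.
have hpa := size_mul_leq_deg hp ha; have hqb := size_mul_leq_deg hq hb.
have hP : (size (p * a + q * b)%R <= (N + m).+1)%N.
  by rewrite (leq_trans (size_polyD _ _))// geq_max hpa hqb.
have : zeros_poly s %| reversal (N + m) (p * a + q * b).
  rewrite reversalD !reversalM// -(dvdpZr _ _ k0).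
  rewrite scalerDr !scalerAr ra rb scaleNr mulrN -!scalerAr -scalerBr.
  by rewrite -mul_polyC dvdp_mull.
case/dvdpP => v hv.
(* size_Mmonic needs a nonzero cofactor. *)
have [v0|v0] := eqVneq v 0.
  exists 0; rewrite ?size_poly0// mulr0; apply/eqP; rewrite -(reversal_eq0 hP) hv v0 mul0r//.
have sv : (size v <= m.+1)%N.
  have := size_reversal (N + m) (p * a + q * b).
  rewrite hv size_Mmonic ?zer_monic// size_zer -/N; move: (size v) => k; lia.
have e : p * a + q * b = den_poly s * reversal m v.
  by rewrite -(reversalK hP) hv mulrC reversalM ?size_zer// reversal_zer.
have : zeros_poly s %| reversal m v.
  rewrite e Gauss_dvdpr// in d1; apply: coprime_zer => c cs.
  by apply: den_horner_neq0 => //; apply: ltW; exact: hs.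
case/dvdpP => w hw; exists w; last by rewrite e hw mulrCA mulrA mulrC [w * _]mulrC mulrA.
have [->|w0] := eqVneq w 0; first by rewrite size_poly0.
have := size_reversal m v; rewrite hw size_Mmonic ?zer_monic// size_zer -/N.
rewrite /m; move: (size w) => k; lia.
Qed.

End Evaluation.

(** * Divisibility from local bounds *)

Section LocalBounds.
Local Open Scope classical_set_scope.
Variable K : numFieldType.
Implicit Types (p q : {poly K}) (s : seq K) (b z : K) (h w : K -> K).

Definition bounded_near b h : Prop :=
  exists2 M : K, 0 <= M & \forall z \near b^', `|h z| <= M.

(** Landau's h = O(w) in a punctured neighbourhood of b. *)
Definition dominated b w h : Prop :=
  exists2 M : K, 0 <= M & \forall z \near b^', `|h z| <= M * `|w z|.

Lemma near_dist b (e : K) : 0 < e -> \forall z \near b^', `|b - z| < e.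
Proof.
move=> e0; apply: nbhs_dnbhs.
exact: (@cvgr_dist_lt _ _ _ _ (nbhs_filter b) id b cvg_id _ e0).
Qed.

Lemma near_disc b : `|b| < 1 -> \forall z \near b^', `|z| < 1.
Proof.
move=> hb; have b1 : 0 < 1 - `|b| by rewrite subr_gt0.
apply: filterS (near_dist b b1) => z.
rewrite ltrBrDl => /(le_lt_trans _); apply.
by rewrite -{1}[z](subrK b) addrC distrC ler_normD.
Qed.

Lemma near_neq b (c : K) : \forall z \near b^', z != c.
Proof.
have [->|cb] := eqVneq c b; first exact: nbhs_dnbhs_neq.
have e : 0 < `|b - c| by rewrite normr_gt0 subr_eq0 eq_sym.
by apply: filterS (near_dist b e) => z; apply: contraTneq => ->; rewrite ltxx.
Qed.

Lemma bounded_near_cst b (c : K) : bounded_near b (fun=> c).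
Proof. by exists `|c| => //; exact: nearW. Qed.

Lemma bounded_nearM b h h' : bounded_near b h -> bounded_near b h' ->
  bounded_near b (fun z => h z * h' z).
Proof.
move=> [M M0 hM] [M' M0' hM']; exists (M * M'); first exact: mulr_ge0.
by near=> z; rewrite normrM ler_pM//; near: z.
Unshelve. all: by end_near. Qed.

Lemma continuous_horner_num p : continuous (horner p).
Proof.
elim/poly_ind: p => [|p c IH] z.
  have -> : horner (0 : {poly K}) = cst 0 by apply/funext => x; rewrite horner0.
  exact: cst_continuous.
have -> : horner (p * 'X + c%:P) = (fun x => p.[x] * x + c).
  by apply/funext => x; rewrite hornerMXaddC.
have pz : (fun x : K => p.[x] * x) @ z --> p.[z] * z.
  by apply: (cvgM (IH z)); exact: cvg_id.
by apply: (cvgD pz); exact: cvg_cst.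
Qed.

Lemma bounded_near_continuous b h :
  {for b, continuous h} -> bounded_near b h.
Proof.
move=> hc; exists (`|h b| + 1); first by rewrite addr_ge0.
have H : `|h b| < `|h b| + 1 by rewrite ltrDl.
apply: (@nbhs_dnbhs _ b).
have := cvgr_norm_lt (h b) hc _ H.
by move=> /(_ (nbhs_filter b)); apply: filterS => z /ltW.
Qed.

Lemma bounded_near_horner b p : bounded_near b (horner p).
Proof. by apply: bounded_near_continuous; exact: continuous_horner_num. Qed.

Lemma dominatedD b w h h' : dominated b w h -> dominated b w h' ->
  dominated b w (fun z => h z + h' z).
Proof.
move=> [M M0 hM] [M' M0' hM']; exists (M + M'); first exact: addr_ge0.
near=> z; rewrite mulrDl (le_trans (ler_normD _ _))// lerD//.
  by near: z.
by near: z.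
Unshelve. all: by end_near. Qed.

Lemma dominatedM b w h h' : bounded_near b h' -> dominated b w h ->
  dominated b w (fun z => h' z * h z).
Proof.
move=> [M M0 hM] [M' M0' hM']; exists (M * M'); first exact: mulr_ge0.
near=> z; rewrite normrM -mulrA ler_pM//; by near: z.
Unshelve. all: by end_near. Qed.

Lemma dominated_near b w h h' : (\forall z \near b^', h z = h' z) ->
  dominated b w h -> dominated b w h'.
Proof.
move=> e [M M0 hM]; exists M => //; near=> z.
have <- : h z = h' z by near: z.
by near: z.
Unshelve. all: by end_near. Qed.

Lemma dominated_mul b w k : bounded_near b k -> dominated b w (fun z => k z * w z).
Proof.
move=> hk; apply: dominatedM => //; exists 1 => //.
by near=> z; rewrite mul1r.
Unshelve. all: by end_near. Qed.

Lemma dominated_root b (w p : {poly K}) :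
  w.[b] = 0 -> dominated b (horner w) (horner p) -> p.[b] = 0.
Proof.
move=> wb [M M0 hM]; apply/eqP; apply: contraT => pb.
have M2 : 0 < M + 2 by rewrite ltr_wpDl.
pose eps := `|p.[b]| / (M + 2); have e0 : 0 < eps by rewrite divr_gt0// normr_gt0.
have near_b q : \forall z \near b^', `|q.[b] - q.[z]| < eps.
  apply: (@nbhs_dnbhs _ b).
  exact: (@cvgr_dist_lt _ _ _ _ (nbhs_filter b) _ _ (@continuous_horner_num q b) _ e0).
have : \forall z \near b^', False.
  near=> z.
  have h1 : `|p.[b] - p.[z]| < eps by near: z; exact: near_b.
  have h2 : `|w.[z]| < eps by rewrite -normrN -[- _]add0r -wb; near: z; exact: near_b.
  have h3 : `|p.[z]| <= M * `|w.[z]| by near: z.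
  have : `|p.[b]| < eps * (M + 2).
    rewrite -(subrK p.[z] p.[b]) (le_lt_trans (ler_normD _ _))//.
    rewrite (_ : eps * (M + 2) = eps + (M * eps + eps)); last by ring.
    rewrite ltrD// (le_lt_trans h3)// (le_lt_trans (ler_wpM2l M0 (ltW h2)))// ltrDl//.
  by rewrite /eps divfK ?gt_eqF// ltxx.
by move/filter_ex => [].
Unshelve. all: by end_near. Qed.

(** Local boundedness is enough to count zeros with multiplicity: a linear factor
    common to both sides is removed at a time, the bound being needed only near
    the roots and off them. *)
Lemma dvdp_dominated s p :
  (forall b, b \in s -> dominated b (horner (\prod_(a <- s) ('X - a%:P))) (horner p)) ->
  \prod_(a <- s) ('X - a%:P) %| p.
Proof.
elim: s p => [|b s IH] p hs; first by rewrite big_nil dvd1p.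
have : root p b.
  apply/rootP; apply: (dominated_root (w := \prod_(a <- b :: s) ('X - a%:P)));
    last by apply: hs; rewrite mem_head.
  by rewrite big_cons hornerM hornerXsubC subrr mul0r.
case/factor_theorem => q hq; rewrite hq big_cons mulrC dvdp_mul2r ?polyXsubC_eq0//.
apply: IH => c cs; have [|M M0 hM] := hs c; first by rewrite in_cons cs orbT.
exists M => //; near=> z; have zb : z != b by near: z; exact: near_neq.
have zb0 : 0 < `|z - b| by rewrite normr_gt0 subr_eq0.
have : `|p.[z]| <= M * `|(\prod_(a <- b :: s) ('X - a%:P)).[z]| by near: z.
rewrite hq big_cons !hornerM hornerXsubC !normrM.
by rewrite [`|z - b| * _]mulrC mulrA ler_pM2r.
Unshelve. all: by end_near. Qed.

End LocalBounds.

(** * Integration over the circle *)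

Section CircleIntegral.
Local Open Scope classical_set_scope.
Variable R : realType.
Local Notation C := R[i].
Local Notation Re := (@complex.Re R).
Local Notation Im := (@complex.Im R).

Lemma normc_ge_Im (x : C) : (`|Im x|)%:C%C <= `|x|.
Proof.
have -> : Im x = - Re (x * 'i%C) by rewrite ReiNIm opprK.
rewrite normrN (le_trans (normc_ge_Re _))// normrM.
by rewrite (_ : `|'i%C| = 1 :> C) ?mulr1// normc_def /= expr0n expr1n add0r sqrtr1.
Qed.

(** Real and imaginary parts are covered at once: the preimage of an open ray
    under a 1-Lipschitz function is open. *)
Lemma measurable_lipschitz (f : C -> R) :
  (forall x y, (`|f x - f y|)%:C%C <= `|x - y|) ->
  measurable_fun [set: borelC R] (f : borelC R -> R).
Proof.
move=> lip.
apply: (measurability _ (RGenOInfty.measurableE R)) => _ [_ [a ->] <-].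
rewrite setTI; apply: sub_sigma_algebra => /=; rewrite openE => z /=.
rewrite in_itv/= andbT => az; apply/nbhs_ballP => /=.
exists (f z - a)%:C%C; first by rewrite /= ltcR subr_gt0.
move=> y; rewrite -ball_normE /= => zy; rewrite in_itv/= andbT.
have := le_lt_trans (lip z y) zy; rewrite ltcR => /(le_lt_trans (ler_norm _)).
by rewrite ltrD2l ltrN2.
Qed.

Lemma measurable_Re : measurable_fun [set: borelC R] (Re : borelC R -> R).
Proof.
apply: measurable_lipschitz => x y.
by rewrite -raddfB; exact: normc_ge_Re.
Qed.

Lemma measurable_Im : measurable_fun [set: borelC R] (Im : borelC R -> R).
Proof.
apply: measurable_lipschitz => x y.
by rewrite -raddfB; exact: normc_ge_Im.
Qed.

Local Notation circ := (@unit_circle R : set (borelC R)).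

Lemma circle_ReIm (t : C) : (`|t| == 1) = (Re t ^+ 2 + Im t ^+ 2 == 1).
Proof.
rewrite -[LHS](@eqrXn2 _ 2)// expr1n -add_Re2_Im2 -(rmorph1 (real_complex R)).
by rewrite (inj_eq (@complexI R)).
Qed.

Lemma measurable_circle : measurable circ.
Proof.
have m : measurable_fun [set: borelC R] (fun t : borelC R => Re t ^+ 2 + Im t ^+ 2).
  by apply: measurable_funD; apply: measurable_funX; [exact: measurable_Re|exact: measurable_Im].
have := m measurableT [set 1] (measurable_set1 1).
rewrite setTI; congr (measurable _); apply/seteqP; split => t /=.
  by move/eqP; rewrite -circle_ReIm => /eqP.
by move/eqP; rewrite circle_ReIm => /eqP.
Qed.

(** A class of integrable functions that is closed under products as well as
    sums, unlike integrability itself. *)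
Definition circle_fun (h : C -> C) : Prop :=
  [/\ measurable_fun circ (fun t : borelC R => Re (h t)),
      measurable_fun circ (fun t : borelC R => Im (h t))
    & exists M : R, forall t : C, `|t| = 1 -> `|h t| <= M%:C%C].

Lemma circle_fun_eq h h' : (forall t, `|t| = 1 -> h t = h' t) ->
  circle_fun h -> circle_fun h'.
Proof.
move=> e [m1 m2 [M hM]]; split.
- apply: eq_measurable_fun m1 => t; rewrite inE => ht; congr Re; exact: e.
- apply: eq_measurable_fun m2 => t; rewrite inE => ht; congr Im; exact: e.
- by exists M => t ht; rewrite -e// hM.
Qed.

Lemma circle_fun_cst c : circle_fun (fun=> c).
Proof.
split; [exact: measurable_cst|exact: measurable_cst|].
by exists (Num.sqrt (Re c ^+ 2 + Im c ^+ 2)) => t _; rewrite normc_def.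
Qed.

Lemma circle_fun_id : circle_fun id.
Proof.
split; [apply: measurable_funS measurable_Re|apply: measurable_funS measurable_Im|];
  rewrite ?measurable_circle//.
by exists 1 => t ->.
Qed.

Lemma circle_funD h h' : circle_fun h -> circle_fun h' -> circle_fun (fun t => h t + h' t).
Proof.
move=> [m1 m2 [M hM]] [m1' m2' [M' hM']]; split.
- have -> : (fun t : borelC R => Re (h t + h' t)) = (fun t : borelC R => Re (h t) + Re (h' t)).
    by apply/funext => t; rewrite raddfD.
  exact: measurable_funD.
- have -> : (fun t : borelC R => Im (h t + h' t)) = (fun t : borelC R => Im (h t) + Im (h' t)).
    by apply/funext => t; rewrite raddfD.
  exact: measurable_funD.
exists (M + M') => t ht; rewrite rmorphD/= (le_trans (ler_normD _ _))// lerD ?hM ?hM'//.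
Qed.

Lemma circle_funM h h' : circle_fun h -> circle_fun h' -> circle_fun (fun t => h t * h' t).
Proof.
move=> [m1 m2 [M hM]] [m1' m2' [M' hM']]; split.
- have -> : (fun t : borelC R => Re (h t * h' t)) =
      (fun t : borelC R => Re (h t) * Re (h' t) - Im (h t) * Im (h' t)).
    by apply/funext => t; case: (h t) => a b; case: (h' t).
  by apply: measurable_funB; exact: measurable_funM.
- have -> : (fun t : borelC R => Im (h t * h' t)) =
      (fun t : borelC R => Re (h t) * Im (h' t) + Im (h t) * Re (h' t)).
    by apply/funext => t; case: (h t) => a b; case: (h' t).
  by apply: measurable_funD; exact: measurable_funM.
by exists (M * M') => t ht; rewrite normrM rmorphM ler_pM ?hM ?hM'.
Qed.

Lemma circle_funN h : circle_fun h -> circle_fun (fun t => - h t).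
Proof.
move=> ch; apply: circle_fun_eq (circle_funM (circle_fun_cst (-1)) ch) => t _.
exact: mulN1r.
Qed.

Lemma circle_fun_conj h : circle_fun h -> circle_fun (fun t => conjc (h t)).
Proof.
move=> [m1 m2 [M hM]]; split.
- by apply: eq_measurable_fun m1 => t _; case: (h t).
- apply: eq_measurable_fun (measurable_funN m2) => t _ /=; by case: (h t).
- by exists M => t ht; rewrite normcJ hM.
Qed.

(** 1 / h = conj h / |h|^2, and the inverse of the positive function |h|^2 is
    measurable as its power of exponent -1. *)
Lemma circle_funV h : (exists2 m : R, 0 < m & forall t, `|t| = 1 -> m%:C%C <= `|h t|) ->
  circle_fun h -> circle_fun (fun t => (h t)^-1).
Proof.
move=> [m m0 hm] hh; have [_ _ [M hM]] := circle_fun_conj hh.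
have [m1 m2 _] := hh.
pose n2 (t : borelC R) := Re (h t) ^+ 2 + Im (h t) ^+ 2.
have mn : measurable_fun circ n2.
  by apply: measurable_funD; exact: measurable_funX.
pose k (t : C) : C := ((n2 t)^-1)%:C%C.
have hk : circle_fun k.
  split; [|exact: measurable_cst|].
    have -> : (fun t : borelC R => Re (k t)) = (fun t : borelC R => (n2 t) `^ (-1)).
      by apply/funext => t; rewrite powR_inv1// addr_ge0 ?sqr_ge0.
    exact: (measurableT_comp (measurable_powR (-1)) mn).
  exists (m ^+ 2)^-1 => t ht; rewrite ger0_norm ?ler0c ?invr_ge0 ?addr_ge0 ?sqr_ge0//.
  rewrite lecR lef_pV2 ?posrE ?exprn_gt0//; last first.
    by rewrite -ltcR rmorph0 add_Re2_Im2 exprn_gt0// (lt_le_trans _ (hm t ht))// ltcR.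
  rewrite -lecR add_Re2_Im2 rmorphXn /=.
  have mC : 0 <= m%:C%C by rewrite ler0c ltW.
  exact: (lerXn2r _ mC (normr_ge0 (h t)) (hm t ht)).
apply: circle_fun_eq (circle_funM hk (circle_fun_conj hh)) => t ht.
by rewrite [RHS]invc_norm /k -add_Re2_Im2 -fmorphV.
Qed.

Lemma circle_fun_horner p : circle_fun (horner p).
Proof.
elim/poly_ind: p => [|p c IH].
  by apply: circle_fun_eq (circle_fun_cst 0) => t _; rewrite horner0.
apply: circle_fun_eq (circle_funD (circle_funM IH circle_fun_id) (circle_fun_cst c)) => t _.
by rewrite hornerMXaddC.
Qed.

Lemma circle_fun_sum n (h : nat -> C -> C) : (forall i, circle_fun (h i)) ->
  circle_fun (fun t => \sum_(i < n) h i t).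
Proof.
move=> hh; elim: n => [|n IH].
  by apply: circle_fun_eq (circle_fun_cst 0) => t _; rewrite big_ord0.
by apply: circle_fun_eq (circle_funD IH (hh n)) => t _; rewrite big_ord_recr.
Qed.

Lemma circle_fun_inv_sub z : `|z| != 1 -> circle_fun (fun t => (t - z)^-1).
Proof.
move=> z1; apply: circle_funV; last first.
  exact: circle_funD circle_fun_id (circle_fun_cst (- z)).
have d0 : 0 < `|1 - `|z| | by rewrite normr_gt0 subr_eq0 eq_sym.
exists (Re `|1 - `|z| |).
  by move: d0; rewrite ltcE => /andP[].
move=> t ht; have := ler_dist_dist t z; rewrite ht => /(le_trans _); apply.
by rewrite RRe_real// ger0_real.
Qed.

Lemma circle_fun_inv_zer s : in_disc s -> circle_fun (fun t => ((zeros_poly s).[t])^-1).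
Proof.
elim: s => [|b s IH] hs.
  by apply: circle_fun_eq (circle_fun_cst 1) => t _; rewrite /zeros_poly big_nil hornerC invr1.
have hb : `|b| != 1 by rewrite lt_eqF// hs// mem_head.
have hs' : in_disc s by move=> c cs; apply: hs; rewrite in_cons cs orbT.
apply: circle_fun_eq (circle_funM (circle_fun_inv_sub hb) (IH hs')) => t _.
by rewrite zer_cons hornerM hornerXsubC invfM.
Qed.

Lemma circle_conj (t : C) : `|t| = 1 -> conjc t = t^-1.
Proof.
by move=> ht; rewrite [RHS]invc_norm ht expr1n invr1 mul1r.
Qed.

Lemma circle_neq0 (t : C) : `|t| = 1 -> t != 0.
Proof. by move=> ht; rewrite -normr_eq0 ht oner_eq0. Qed.

Lemma conj_horner_circle n (p : {poly C}) t : `|t| = 1 -> (size p <= n.+1)%N ->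
  conjc p.[t] = (reversal n p).[t] / t ^+ n.
Proof.
move=> ht hp; have t0 := circle_neq0 ht.
rewrite (horner_reversal t0 hp) circle_conj// invrK mulrC mulKf// expf_neq0//.
Qed.

(** On the circle den_poly s is t^n times the conjugate of zeros_poly s. *)
Lemma circle_fun_inv_den s : in_disc s -> circle_fun (fun t => ((den_poly s).[t])^-1).
Proof.
move=> hs.
have h1 := circle_fun_conj (circle_funM (circle_fun_horner 'X^(size s)) (circle_fun_inv_zer hs)).
apply: circle_fun_eq h1 => t ht.
rewrite hornerXn rmorphM fmorphV rmorphXn /= (conj_horner_circle ht (n := size s)) ?size_zer//.
rewrite reversal_zer circle_conj// invfM invrK mulrCA exprVn.
by rewrite mulVf ?mulr1// expf_neq0// circle_neq0.
Qed.

Section Integral.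
Variable mu : probability (borelC R) R.
Hypothesis mu1 : on_circle mu.
Local Notation "\int f" := (cintegral mu f) (at level 36).

Lemma circle_integrable (f : C -> R) :
  measurable_fun circ (f : borelC R -> R) -> (exists M, forall t, `|t| = 1 -> `|f t| <= M) ->
  mu.-integrable circ (EFin \o (f : borelC R -> R)).
Proof.
move=> mf [M hM]; apply: measurable_bounded_integrable => //.
- exact: measurable_circle.
- by rewrite (le_lt_trans (probability_le1 _ measurable_circle))// ltry.
- exists M; split; first exact: num_real.
  by move=> x Mx t /= ht; rewrite (le_trans (hM t ht))// ltW.
Qed.

Lemma integrable_Re h :
  circle_fun h -> mu.-integrable circ (EFin \o (fun t : borelC R => Re (h t))).
Proof.
move=> [m1 _ [M hM]]; apply: circle_integrable => //; exists M => t ht.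
by rewrite -lecR (le_trans (normc_ge_Re _))// hM.
Qed.

Lemma integrable_Im h :
  circle_fun h -> mu.-integrable circ (EFin \o (fun t : borelC R => Im (h t))).
Proof.
move=> [_ m1 [M hM]]; apply: circle_integrable => //; exists M => t ht.
by rewrite -lecR (le_trans (normc_ge_Im _))// hM.
Qed.

Lemma eq_cintegral h h' : (forall t, `|t| = 1 -> h t = h' t) -> \int h = \int h'.
Proof.
by move=> e; rewrite /cintegral; congr Complex; apply: eq_Rintegral => t;
  rewrite inE /= => ht; rewrite e.
Qed.

Lemma cintegralD h h' : circle_fun h -> circle_fun h' ->
  \int (fun t => h t + h' t) = \int h + \int h'.
Proof.
move=> ch ch'; rewrite /cintegral [RHS]/GRing.add/=; congr Complex.
- rewrite -RintegralD; [|exact: measurable_circle|exact: integrable_Re|exact: integrable_Re].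
  by apply: eq_Rintegral => t _; rewrite raddfD.
- rewrite -RintegralD; [|exact: measurable_circle|exact: integrable_Im|exact: integrable_Im].
  by apply: eq_Rintegral => t _; rewrite raddfD.
Qed.

Lemma cintegralZ a h : circle_fun h -> \int (fun t => a * h t) = a * \int h.
Proof.
move=> ch; have mc := measurable_circle.
have iR := integrable_Re ch; have iI := integrable_Im ch.
have iZ (k : R) f : mu.-integrable circ (EFin \o f) ->
    mu.-integrable circ (EFin \o (fun t : borelC R => k * f t)).
  by move=> i; exact: (integrableZl mc k i).
case: a => a b; rewrite /cintegral [RHS]/GRing.mul/=; congr Complex.
- rewrite -!RintegralZl// -RintegralB//; [|exact: iZ|exact: iZ].
  by apply: eq_Rintegral => t _; case: (h t).
- rewrite -!RintegralZl// -RintegralD//; [|exact: iZ|exact: iZ].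
  by apply: eq_Rintegral => t _; case: (h t).
Qed.

Lemma cintegral_conj h : circle_fun h -> \int (fun t => conjc (h t)) = conjc (\int h).
Proof.
move=> ch; rewrite /cintegral /=; congr Complex.
  by apply: eq_Rintegral => t _; case: (h t).
rewrite -[RHS]mulN1r -RintegralZl; [|exact: measurable_circle|exact: integrable_Im].
by apply: eq_Rintegral => t _; rewrite mulN1r; case: (h t).
Qed.

Lemma Rintegral_circle_cst (x : R) : \int[mu]_(_ in circ) x = x.
Proof.
rewrite (Rintegral_cst _ measurable_circle) -[RHS]mulr1; congr (_ * _).
exact: (congr1 fine mu1).
Qed.

Lemma cintegral_cst a : \int (fun=> a) = a.
Proof. by rewrite /cintegral; case: a => a b /=; rewrite !Rintegral_circle_cst. Qed.

Lemma cintegral_sum n (h : nat -> C -> C) : (forall i, circle_fun (h i)) ->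
  \int (fun t => \sum_(i < n) h i t) = \sum_(i < n) \int (h i).
Proof.
move=> hh; elim: n => [|n IH].
  rewrite big_ord0 -[RHS](cintegral_cst 0); apply: eq_cintegral => t _; exact: big_ord0.
rewrite big_ord_recr /= -IH -cintegralD//; last exact: circle_fun_sum.
by apply: eq_cintegral => t _; rewrite big_ord_recr.
Qed.

(** The constant 2 comes from bounding real and imaginary parts separately;
    only boundedness matters below. *)
Lemma norm_cintegral_le (M : R) h : circle_fun h -> (forall t, `|t| = 1 -> `|h t| <= M%:C%C) ->
  `|\int h| <= (M + M)%:C%C.
Proof.
move=> ch hM; have mc := measurable_circle.
have bound f : mu.-integrable circ (EFin \o (f : borelC R -> R)) ->
    (forall t, `|t| = 1 -> `|f t| <= M) -> `|\int[mu]_(t in circ) f t| <= M.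
  move=> i fM; apply: le_trans (le_normr_Rintegral mc i) _.
  rewrite -[leRHS]Rintegral_circle_cst.
  apply: le_Rintegral => //.
  - exact: integrable_norm.
  - apply: (@circle_integrable (fun=> M)); first exact: measurable_cst.
    by exists `|M|.
rewrite /cintegral; set x := \int[_]_(_ in _) _; set y := \int[_]_(_ in _) _.
have -> : Complex x y = x%:C%C + 'i%C * y%:C%C by rewrite [LHS]complexE.
rewrite rmorphD (le_trans (ler_normD _ _))// normrM.
have hi : `|'i%C| = 1 :> C by rewrite normc_def /= expr0n expr1n add0r sqrtr1.
rewrite hi mul1r !normc_def /= !expr0n !addr0 !sqrtr_sqr lerD// lecR; apply: bound.
- exact: integrable_Re.
- by move=> t ht; rewrite -lecR (le_trans (normc_ge_Re _))// hM.
- exact: integrable_Im.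
- by move=> t ht; rewrite -lecR (le_trans (normc_ge_Im _))// hM.
Qed.

End Integral.
End CircleIntegral.

(** * The kernel and the numerator of a function of the second kind *)

(** With c = conj b this writes D_0(t, z) as 1 + const (z - b) (1 - conj(b) t) / (t - z),
    which isolates the zero of D_0 - 1 at z = b. *)
Lemma blaschke_kernel (K : fieldType) (e b c t z : K) :
  e != 0 -> 1 - c * t != 0 -> 1 - c * z != 0 -> t - z != 0 -> 1 - c * b != 0 ->
  (e * (t - b) / (1 - c * t) + e * (z - b) / (1 - c * z))
    / (e * (t - b) / (1 - c * t) - e * (z - b) / (1 - c * z)) =
  1 + 2%:R / (1 - c * b) * (z - b) * ((1 - c * t) / (t - z)).
Proof.
move=> e0 t0 z0 tz b0.
have -> : e * (t - b) / (1 - c * t) - e * (z - b) / (1 - c * z) =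
    e * (t - z) * (1 - c * b) / ((1 - c * t) * (1 - c * z)).
  by field; rewrite t0 z0.
by field; rewrite t0 z0 tz b0 e0.
Qed.

(** The symmetry conj D_0(t, 1/conj z) = - D_0(t, z) for t on the circle, written
    with c = conj b and conj t = 1/t. *)
Lemma reflected_kernel (K : fieldType) (b c t z : K) :
  t != 0 -> z != 0 -> t - z != 0 -> 1 - c * b != 0 ->
  1 + 2%:R / (1 - c * b) * (z^-1 - c) * ((1 - b * t^-1) / (t^-1 - z^-1)) =
  - (1 + 2%:R / (1 - c * b) * (z - b) * ((1 - c * t) / (t - z))).
Proof.
move=> t0 z0 tz b0.
have -> : t^-1 - z^-1 = - (t - z) / (t * z) by field; rewrite t0 z0.
by field; rewrite oppr_eq0 t0 z0 tz b0.
Qed.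

Lemma morph_kernel (K : fieldType) (f : {rmorphism K -> K}) (k w b c t : K) :
  f (1 + k * (w - b) * ((1 - c * t) / (t - w))) =
  1 + f k * (f w - f b) * ((1 - f c * f t) / (f t - f w)).
Proof. by rewrite rmorphD rmorph1 !rmorphM fmorphV !rmorphB rmorph1 rmorphM. Qed.

Lemma morph_ker_cst (K : fieldType) (f : {rmorphism K -> K}) (b c : K) :
  f (2%:R / (1 - c * b)) = 2%:R / (1 - f c * f b).
Proof. by rewrite rmorphM fmorphV rmorphB rmorph1 rmorphM rmorph_nat. Qed.

(** At a point w off the circle, synthetic division by X - t evaluates to division
    by w - t. *)
Lemma second_kind_integrand (K : fieldType) (v t w pt pit pw piw : K) :
  t - w != 0 -> pit != 0 ->
  v / (t - w) * (pt / pit * piw - pw) =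
  -1 * (v / pit * ((pt * piw - pit * pw) / (w - t))).
Proof.
move=> tw pi0; have wt : w - t != 0 by rewrite -opprB oppr_eq0.
by field; rewrite tw wt pi0.
Qed.

Section Kernel.
Variable R : realType.
Local Notation C := R[i].
Local Notation rat := (ratfun R).
Variable b : C.
Hypothesis hb : `|b| < 1.

(** [kerD b t z] is [herglotz t z] for z in the disc. The closed form is used
    outside the disc as well. *)
Definition cauchy_ker (t z : C) : C := (varpi_poly b).[t] / (t - z).
Definition ker_cst : C := 2%:R / (1 - conjc b * b).
Definition herglotz (t z : C) : C := 1 + ker_cst * (z - b) * cauchy_ker t z.

Lemma horner_varpi x : (varpi_poly b).[x] = 1 - conjc b * x.
Proof. by rewrite /varpi_poly !hornerE. Qed.

Lemma circle_sub_neq0 (t z : C) : `|t| = 1 -> `|z| != 1 -> t - z != 0.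
Proof. by move=> ht; rewrite subr_eq0; apply: contra_neq => <-. Qed.

Lemma one_sub_conj_mul_neq0 : 1 - conjc b * b != 0.
Proof. by rewrite -horner_varpi horner_varpi_neq0// ltW. Qed.

Lemma feval_zeta (x : C) : `|x| <= 1 ->
  feval (zeta b) x = eta_at b * (x - b) / (1 - conjc b * x).
Proof.
move=> hx; have -> : zeta b = tofrac ((eta_at b)%:P * ('X - b%:P)) / tofrac (varpi_poly b).
  by rewrite /zeta /ratcst /varpi_star /varpi rmorphM.
by rewrite feval_frac ?horner_varpi_neq0// hornerM hornerC hornerXsubC horner_varpi.
Qed.

Lemma kerDE (t z : C) : `|t| = 1 -> `|z| < 1 -> kerD b t z = herglotz t z.
Proof.
move=> ht hz; rewrite /kerD !feval_zeta ?ht ?(ltW hz)//.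
rewrite /herglotz /cauchy_ker horner_varpi.
apply: blaschke_kernel.
- exact: eta_neq0.
- by rewrite -horner_varpi horner_varpi_neq0// ht.
- by rewrite -horner_varpi horner_varpi_neq0// ltW.
- by apply: circle_sub_neq0 => //; rewrite lt_eqF.
- exact: one_sub_conj_mul_neq0.
Qed.

Lemma conj_ker_cst : conjc ker_cst = ker_cst.
Proof.
by rewrite /ker_cst (morph_ker_cst (@conjc R)) /= conjcK [b * _]mulrC.
Qed.

Lemma conj_herglotz (t z : C) : `|t| = 1 -> `|z| < 1 -> z != 0 ->
  conjc (herglotz t (conjc z)^-1) = - herglotz t z.
Proof.
move=> ht hz z0; rewrite /herglotz /cauchy_ker !horner_varpi.
rewrite (morph_kernel (@conjc R)) /= conj_ker_cst fmorphV /= !conjcK (circle_conj ht).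
rewrite /ker_cst; apply: reflected_kernel => //; first exact: circle_neq0.
- by apply: circle_sub_neq0 => //; rewrite lt_eqF.
- exact: one_sub_conj_mul_neq0.
Qed.

Lemma circle_fun_cauchy z : `|z| != 1 -> circle_fun (fun t => cauchy_ker t z).
Proof.
by move=> hz; exact: circle_funM (circle_fun_horner _) (circle_fun_inv_sub hz).
Qed.

Lemma circle_fun_herglotz z : `|z| != 1 -> circle_fun (fun t => herglotz t z).
Proof.
move=> hz; apply: circle_funD; first exact: circle_fun_cst.
by apply: circle_funM; [exact: circle_fun_cst|exact: circle_fun_cauchy].
Qed.

Variable mu : probability (borelC R) R.
Hypothesis mu1 : on_circle mu.
Local Notation "\int f" := (cintegral mu f) (at level 36).

Lemma cintegral_herglotz z h : `|z| != 1 -> circle_fun h ->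
  \int (fun t => herglotz t z * h t) =
  \int h + ker_cst * (z - b) * \int (fun t => cauchy_ker t z * h t).
Proof.
move=> hz ch; rewrite -cintegralZ//; last first.
  by apply: circle_funM => //; exact: circle_fun_cauchy.
rewrite -cintegralD//; last first.
  apply: circle_funM; first exact: circle_fun_cst.
  by apply: circle_funM => //; exact: circle_fun_cauchy.
by apply: eq_cintegral => t _; rewrite /herglotz mulrDl mul1r !mulrA.
Qed.

(** |t - z| is bounded below for t on the circle and z near a point of the disc.
    Boundedness stands in for holomorphy in z of the integral. *)
Lemma bounded_near_cauchy h (g : C) : circle_fun h -> `|g| < 1 ->
  bounded_near g (fun z => \int (fun t => cauchy_ker t z * h t)).
Proof.
move=> ch hg; have [_ _ [M hM]] := circle_funM (circle_fun_horner (varpi_poly b)) ch.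
pose r := complex.Re `|g|; have rE : `|g| = r%:C%C by rewrite /r RRe_real// normr_real.
pose d := (1 - r) / 2%:R.
have d0 : 0 < d by rewrite divr_gt0// subr_gt0 -ltcR -rE.
have dC : 0 < d%:C%C :> C by rewrite ltcR.
have M0 : 0 <= M.
  by rewrite -ler0c (le_trans _ (hM 1 _))// normr1.
exists (M / d + M / d)%:C%C; first by rewrite ler0c addr_ge0// divr_ge0// ltW.
apply: filterS (near_dist g dC) => z hz.
have tz t : `|t| = 1 -> d%:C%C <= `|t - z|.
  move=> ht; have h1 : `|t| - `|g| <= `|t - g| by exact: lerB_dist.
  have h2 : `|t - g| <= `|t - z| + `|g - z|.
    by rewrite [`|g - z|]distrC; exact: ler_distD.
  rewrite ht rE in h1.
  have h3 : (1 - r)%:C%C = d%:C%C + d%:C%C by rewrite -rmorphD; congr (_%:C%C); rewrite /d; field.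
  rewrite -(lerD2r d%:C%C) -h3 rmorphB rmorph1 (le_trans h1)// (le_trans h2)//.
  by rewrite lerD2l ltW.
have hz1 : `|z| != 1.
  by apply/eqP => z1; have := tz z z1; rewrite subrr normr0 => /(lt_le_trans dC); rewrite ltxx.
apply: norm_cintegral_le => //.
  by apply: circle_funM => //; exact: circle_fun_cauchy.
move=> t ht; rewrite /cauchy_ker mulrAC normrM normfV rmorphM fmorphV/=.
apply: ler_pM => //; rewrite ?invr_ge0//; first exact: hM.
by rewrite lef_pV2 ?posrE ?(lt_le_trans dC)// ?tz.
Qed.

Lemma integral_poly n (h : C -> {poly C}) :
    (forall i, circle_fun (fun t => (h t)`_i)) -> (forall t, (size (h t) <= n)%N) ->
  exists2 q : {poly C}, (size q <= n)%N & forall w,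
    circle_fun (fun t => (h t).[w]) /\ q.[w] = \int (fun t => (h t).[w]).
Proof.
move=> ch sh; exists (\poly_(i < n) \int (fun t => (h t)`_i)); first exact: size_poly.
move=> w; have cw i : circle_fun (fun t => w ^+ i * (h t)`_i).
  by apply: circle_funM => //; exact: circle_fun_cst.
have e t : `|t| = 1 -> \sum_(i < n) w ^+ i * (h t)`_i = (h t).[w].
  move=> _; rewrite (horner_coef_wide _ (sh t)).
  by apply: eq_bigr => i _; rewrite mulrC.
split; first exact: circle_fun_eq e (circle_fun_sum n cw).
rewrite horner_poly -(eq_cintegral mu e).
rewrite (@cintegral_sum R mu mu1 n (fun i t => w ^+ i * (h t)`_i) cw).
by apply: eq_bigr => i _; rewrite mulrC cintegralZ.
Qed.

(** In a synthetic division the coefficients k_j of the quotient satisfy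
    k_j = h_(j+1) + t k_(j+1), hence inherit the class of those of h by descent
    from the top degree. *)
Lemma circle_fun_divX n (h : C -> {poly C}) :
    (forall i, circle_fun (fun t => (h t)`_i)) -> (forall t, (size (h t) <= n.+1)%N) ->
    (forall t, root (h t) t) ->
  (forall t, (size (h t %/ ('X - t%:P))%R <= n)%N) /\
  forall j, circle_fun (fun t => (h t %/ ('X - t%:P))`_j).
Proof.
move=> ch sh rh; pose k t := h t %/ ('X - t%:P).
have hk t : h t = k t * ('X - t%:P) by rewrite divpK// dvdp_XsubCl.
have sk t : (size (k t) <= n)%N.
  by rewrite size_divp ?polyXsubC_eq0// size_XsubC leq_subLR add1n.
split=> // j; have [d] := ubnP (n - j); elim: d j => // d IH j hd.
have [nj|jn] := leqP n j.
  apply: circle_fun_eq (circle_fun_cst 0) => t _.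
  by rewrite nth_default// (leq_trans (sk t)).
have hj : (n - j.+1 < d)%N by lia.
have e t : `|t| = 1 -> (h t)`_j.+1 + t * (k t)`_j.+1 = (k t)`_j.
  by move=> _; rewrite hk mulrBr coefB coefMX /= coefMC [_ * t]mulrC subrK.
apply: (circle_fun_eq e); apply: (circle_funD (ch j.+1)).
exact: (circle_funM (circle_fun_id R) (IH j.+1 hj)).
Qed.

(** For p of the given degree, p(t) pi - pi(t) p, with pi = den_poly s, is divisible by
    X - t, so the integrand is polynomial in w of degree at most that of p and can
    be integrated coefficientwise. The resulting q is the numerator of the function
    of the second kind, and the formula is valid also for |w| > 1, where the
    superstar evaluates it. *)
Lemma second_kind_poly s (p : {poly C}) :
    in_disc s -> (size p <= (size s).+1)%N ->
    let L := \int (fun t => p.[t] / (den_poly s).[t]) in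
  exists2 q : {poly C}, (size q <= (size s).+1)%N & forall w, `|w| != 1 ->
    q.[w] = \int (fun t => herglotz t w * (p.[t] / (den_poly s).[t] * (den_poly s).[w] - p.[w]))
            + L * (den_poly s).[w].
Proof.
move=> hs hp L; set pi := den_poly s.
have cpi := circle_fun_inv_den hs; rewrite -/pi in cpi.
pose h t := p.[t] *: pi - pi.[t] *: p.
have ch i : circle_fun (fun t => (h t)`_i).
  have e t : `|t| = 1 -> pi`_i * p.[t] + (- p`_i) * pi.[t] = (h t)`_i.
    by move=> _; rewrite coefB !coefZ mulNr [pi`_i * _]mulrC [p`_i * _]mulrC.
  by apply: circle_fun_eq e _; apply: circle_funD; apply: circle_funM;
    try exact: circle_fun_cst; exact: circle_fun_horner.
have sh t : (size (h t) <= (size s).+1)%N.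
  rewrite (leq_trans (size_polyD _ _))// geq_max size_polyN.
  by rewrite !(leq_trans (size_scale_leq _ _))// size_den.
have rh t : root (h t) t by rewrite /root !hornerE mulrC subrr.
have [sr cr] := circle_fun_divX ch sh rh.
pose g t := ((varpi_poly b).[t] / pi.[t]) *: (h t %/ ('X - t%:P)).
have [|t|r szr hr] := @integral_poly (size s) g.
- move=> i; have e t : `|t| = 1 ->
        ((varpi_poly b).[t] / pi.[t]) * (h t %/ ('X - t%:P))`_i = (g t)`_i.
    by move=> _; rewrite coefZ.
  apply: circle_fun_eq e _; apply: circle_funM => //.
  by apply: circle_funM => //; exact: circle_fun_horner.
- by rewrite (leq_trans (size_scale_leq _ _)).
exists ((L + L) *: pi - p - ker_cst *: (('X - b%:P) * r)).
  rewrite (leq_trans (size_polyD _ _))// geq_max size_polyN; apply/andP; split.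
    rewrite (leq_trans (size_polyD _ _))// geq_max size_polyN hp andbT.
    by rewrite (leq_trans (size_scale_leq _ _))// size_den.
  rewrite (leq_trans (size_scale_leq _ _))// (leq_trans (size_polyMleq _ _))// size_XsubC.
  by rewrite add2n /= ltnS.
move=> w hw.
have cphi : circle_fun (fun t => p.[t] / pi.[t]).
  by apply: circle_funM => //; exact: circle_fun_horner.
have cphiw : circle_fun (fun t => p.[t] / pi.[t] * pi.[w] - p.[w]).
  apply: circle_funD; last exact: circle_fun_cst.
  by apply: circle_funM => //; exact: circle_fun_cst.
rewrite cintegral_herglotz//.
have -> : \int (fun t => p.[t] / pi.[t] * pi.[w] - p.[w]) = L * pi.[w] - p.[w].
  rewrite cintegralD; [|by apply: circle_funM => //; exact: circle_fun_cst|exact: circle_fun_cst].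
  rewrite cintegral_cst//; congr (_ - _); rewrite [RHS]mulrC -cintegralZ//.
  by apply: eq_cintegral => t _; rewrite mulrC.
have -> : \int (fun t => cauchy_ker t w * (p.[t] / pi.[t] * pi.[w] - p.[w])) = - r.[w].
  have [cr' ->] := hr w; rewrite -[RHS]mulN1r -cintegralZ//.
  apply: eq_cintegral => t ht; have tw := circle_sub_neq0 ht hw.
  have pit : pi.[t] != 0 by apply: den_horner_neq0 => //; rewrite ht.
  have hw' : (h t).[w] = (h t %/ ('X - t%:P)).[w] * (w - t).
    rewrite -{1}(divpK (_ : 'X - t%:P %| h t)) ?dvdp_XsubCl//.
    by rewrite hornerM hornerXsubC.
  have wt : w - t != 0 by rewrite -opprB oppr_eq0.
  rewrite /g hornerZ -[(h t %/ _).[w]](mulfK wt) -hw' /cauchy_ker.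
  have -> : (h t).[w] = p.[t] * pi.[w] - pi.[t] * p.[w].
    by rewrite /h hornerD hornerN !hornerZ.
  exact: second_kind_integrand.
rewrite !(hornerD, hornerN, hornerZ, hornerM, hornerX, hornerC); ring.
Qed.

End Kernel.

(** * Zeros of the two remainders *)

Section Vanishing.
Variable R : realType.
Local Notation C := R[i].
Variables (mu : probability (borelC R) R) (b bN : C) (s1 : seq C).
Hypotheses (mu1 : on_circle mu) (hb : `|b| < 1) (hbN : `|bN| < 1) (hs1 : in_disc s1).
Local Notation "\int f" := (cintegral mu f) (at level 36).
Let s := s1 ++ [:: bN].

Variables (F : C -> C) (p q : {poly C}).
Hypothesis hF : forall z, `|z| < 1 -> F z = \int (fun t => kerD b t z).
Hypotheses (hp : (size p <= (size s).+1)%N) (hq : (size q <= (size s).+1)%N).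
Hypothesis orth : forall u : {poly C}, (size u <= (size s1).+1)%N ->
  \int (fun t => p.[t] / (den_poly s).[t] * (u.[t] / (zeros_poly s1).[t])) = 0.
Hypothesis qE : forall w, `|w| != 1 ->
  q.[w] = \int (fun t => herglotz b t w * (p.[t] / (den_poly s).[t] * (den_poly s).[w] - p.[w])).

Let in_disc_s : in_disc s.
Proof.
move=> x; rewrite mem_cat inE => /orP[/hs1//|/eqP ->]; exact: hbN.
Qed.

Let cphi : circle_fun (fun t => p.[t] / (den_poly s).[t]).
Proof.
by apply: circle_funM; [exact: circle_fun_horner|exact: circle_fun_inv_den].
Qed.

Let mean0 : \int (fun t => p.[t] / (den_poly s).[t]) = 0.
Proof.
rewrite -(orth (u := zeros_poly s1)) ?size_zer//; apply: eq_cintegral => t ht.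
by rewrite divff ?mulr1// zer_horner_neq0// ht.
Qed.

Let normlt1 (z : C) : `|z| < 1 -> `|z| != 1.
Proof. by move=> /lt_eqF ->. Qed.

Lemma F_herglotz z : `|z| < 1 -> F z = \int (fun t => herglotz b t z).
Proof. by move=> hz; rewrite hF//; apply: eq_cintegral => t ht; rewrite kerDE. Qed.

Lemma remainder_cauchy z : `|z| < 1 ->
  p.[z] * F z + q.[z] =
  (den_poly s).[z] * (ker_cst b * (z - b) *
    \int (fun t => cauchy_ker b t z * (p.[t] / (den_poly s).[t]))).
Proof.
move=> hz; have hz1 := normlt1 hz.
have cH := circle_fun_herglotz b hz1.
have cc (a : C) : circle_fun (fun=> a) := circle_fun_cst a.
transitivity (\int (fun t => (den_poly s).[z] * (herglotz b t z * (p.[t] / (den_poly s).[t])))).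
  rewrite F_herglotz// qE// -[p.[z] * _]cintegralZ// -cintegralD; last 2 first.
  - exact: circle_funM.
  - by apply: circle_funM => //; apply: circle_funD => //; exact: circle_funM.
  by apply: eq_cintegral => t _; ring.
rewrite cintegralZ; last exact: circle_funM.
by rewrite cintegral_herglotz// mean0 add0r.
Qed.

(** With omega = zeros_poly s1, the function (1 - conj(b) t) (omega(t) - omega(z)) /
    ((t - z) omega(t)) of t is the substar of an element of the space with points
    s1, hence is annihilated by phi; this brings out the factor omega(z). *)
Lemma cauchy_divisible z : `|z| < 1 ->
  \int (fun t => cauchy_ker b t z * (p.[t] / (den_poly s).[t])) =
  (zeros_poly s1).[z] *
  \int (fun t => cauchy_ker b t z * (p.[t] / (den_poly s).[t] / (zeros_poly s1).[t])).
Proof.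
move=> hz; have hz1 := normlt1 hz.
have cC := circle_fun_cauchy b hz1; have cz := circle_fun_inv_zer hs1.
have cw : circle_fun (fun t => cauchy_ker b t z * (p.[t] / (den_poly s).[t] / (zeros_poly s1).[t])).
  by apply: circle_funM => //; exact: circle_funM.
pose v := (zeros_poly s1 - (zeros_poly s1).[z]%:P) %/ ('X - z%:P).
have hv : v * ('X - z%:P) = zeros_poly s1 - (zeros_poly s1).[z]%:P.
  by rewrite divpK// dvdp_XsubCl /root !hornerE subrr.
have sv : (size v <= size s1)%N.
  rewrite size_divp ?polyXsubC_eq0// size_XsubC /= leq_subLR add1n.
  rewrite (leq_trans (size_polyD _ _))// geq_max size_zer leqnn size_polyN.
  by rewrite (leq_trans (size_polyC_leq1 _)).
have := orth (u := varpi_poly b * v) _.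
rewrite (leq_trans (size_polyMleq _ _)); last first.
  by rewrite -subn1 leq_subLR add1n; exact: (leq_add (size_varpi_poly b) sv).
move=> /(_ isT) o; apply/eqP; rewrite -subr_eq0 -mulNr -[X in _ + X]cintegralZ//.
rewrite -cintegralD; last 2 first.
- exact: circle_funM.
- by apply: circle_funM => //; exact: circle_fun_cst.
rewrite -[X in _ == X]o; apply/eqP; apply: eq_cintegral => t ht.
have tz := circle_sub_neq0 ht hz1.
have zt : (zeros_poly s1).[t] != 0 by rewrite zer_horner_neq0// ht.
have e : v.[t] * (t - z) = (zeros_poly s1).[t] - (zeros_poly s1).[z].
  by rewrite -[t - z]hornerXsubC -hornerM hv hornerD hornerN hornerC.
rewrite hornerM -[v.[t]](mulfK tz) e /cauchy_ker.
by move: (p.[t] / _) => x; field; rewrite zt tz.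
Qed.

Lemma dominated_remainder g : `|g| < 1 ->
  dominated g (horner (zeros_poly (b :: s1))) (fun z => p.[z] * F z + q.[z]).
Proof.
move=> hg.
pose k z := (den_poly s).[z] * ker_cst b *
  \int (fun t => cauchy_ker b t z * (p.[t] / (den_poly s).[t] / (zeros_poly s1).[t])).
have bk : bounded_near g k.
  apply: bounded_nearM; last first.
    by apply: bounded_near_cauchy => //; apply: circle_funM => //; exact: circle_fun_inv_zer.
  by apply: bounded_nearM; [exact: bounded_near_horner|exact: bounded_near_cst].
apply: dominated_near (dominated_mul _ bk); apply: filterS (near_disc hg) => z z1.
rewrite remainder_cauchy// cauchy_divisible// zer_cons hornerM hornerXsubC /k; ring.
Qed.

Let N := size s.

(** Conjugate the formula for q at w = 1/conj z and use the symmetry of the kernel.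
    Only the mean of phi has to vanish here: the zeros come from the factor B_N
    of the superstar. *)
Lemma reversed_remainder z : `|z| < 1 -> z != 0 ->
  (reversal N p).[z] * F z - (reversal N q).[z] =
  (zeros_poly s).[z] * (ker_cst b * (z - b) *
    \int (fun t => cauchy_ker b t z * ((reversal N p).[t] / (zeros_poly s).[t]))).
Proof.
move=> hz z0; have hz1 := normlt1 hz.
pose w := (conjc z)^-1.
have hw : `|w| != 1.
  by rewrite normfV normcJ invr_eq1.
have cs : circle_fun (fun t => (reversal N p).[t] / (zeros_poly s).[t]).
  by apply: circle_funM; [exact: circle_fun_horner|exact: circle_fun_inv_zer].
have cc (a : C) : circle_fun (fun=> a) := circle_fun_cst a.
have cHw := circle_fun_herglotz b hw; have cH := circle_fun_herglotz b hz1.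
have cN : circle_fun (fun t => - herglotz b t z) := circle_funN cH.
have phi_star t : `|t| = 1 ->
    conjc (p.[t] / (den_poly s).[t]) = (reversal N p).[t] / (zeros_poly s).[t].
  move=> ht; rewrite rmorphM fmorphV /= (conj_horner_circle ht hp).
  rewrite (conj_horner_circle ht (size_den s)) reversal_den.
  by rewrite -mulf_div divff ?mulr1// invr_eq0 expf_neq0// circle_neq0.
have mean0s : \int (fun t => (reversal N p).[t] / (zeros_poly s).[t]) = 0.
  by rewrite -(eq_cintegral mu phi_star) cintegral_conj// mean0 rmorph0.
have at_w (r : {poly C}) : (size r <= N.+1)%N -> (reversal N r).[z] = z ^+ N * conjc r.[w].
  exact: horner_reversal.
have conj_q : conjc q.[w] = \int (fun t =>
    - herglotz b t z * ((reversal N p).[t] / (zeros_poly s).[t] *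
        conjc (den_poly s).[w] - conjc p.[w])).
  rewrite qE// -cintegral_conj; last first.
    by apply: circle_funM => //; apply: circle_funD => //; exact: circle_funM.
  apply: eq_cintegral => t ht.
  have cj (x y u v : C) : conjc (x * (y * u - v)) =
      conjc x * (conjc y * conjc u - conjc v) by rewrite rmorphM rmorphB rmorphM.
  by rewrite cj conj_herglotz// phi_star.
rewrite !at_w// conj_q F_herglotz//.
have -> : (zeros_poly s).[z] = z ^+ N * conjc (den_poly s).[w].
  by rewrite -reversal_den at_w// size_den.
transitivity (\int (fun t => z ^+ N * conjc (den_poly s).[w] *
    (herglotz b t z * ((reversal N p).[t] / (zeros_poly s).[t])))).
  rewrite -[X in X - _]cintegralZ// -mulNr -[X in _ + X]cintegralZ; last first.
    by apply: circle_funM => //; apply: circle_funD => //; exact: circle_funM.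
  rewrite -cintegralD; last 2 first.
  - exact: circle_funM.
  - apply: circle_funM => //; apply: circle_funM => //.
    by apply: circle_funD => //; exact: circle_funM.
  by apply: eq_cintegral => t _; ring.
rewrite cintegralZ; last exact: circle_funM.
by rewrite cintegral_herglotz// mean0s add0r.
Qed.

Lemma dominated_reversed g : `|g| < 1 ->
  dominated g (horner (zeros_poly (b :: s1)))
    (fun z => (reversal N p).[z] * F z - (reversal N q).[z]).
Proof.
move=> hg.
pose k z := (z - bN) * ker_cst b *
  \int (fun t => cauchy_ker b t z * ((reversal N p).[t] / (zeros_poly s).[t])).
have bk : bounded_near g k.
  apply: bounded_nearM; last first.
    apply: bounded_near_cauchy => //.
    by apply: circle_funM; [exact: circle_fun_horner|exact: circle_fun_inv_zer].
  apply: bounded_nearM; last exact: bounded_near_cst.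
  have := bounded_near_horner g ('X - bN%:P).
  by congr bounded_near; apply/funext => z; rewrite hornerXsubC.
apply: dominated_near (dominated_mul _ bk).
apply: filterS2 (near_disc hg) (near_neq g 0) => z z1 z0.
rewrite reversed_remainder// zer_cons hornerM hornerXsubC /k.
have -> : (zeros_poly s).[z] = (zeros_poly s1).[z] * (z - bN).
  by rewrite zeros_poly_cat hornerM [zeros_poly [:: bN]]big_seq1 hornerXsubC.
ring.
Qed.

End Vanishing.

(** * Application to an orthogonal function *)

Section Assembly.
Variable R : realType.
Local Notation C := R[i].
Local Notation rat := (ratfun R).
Local Notation cst := (@ratcst R).

(** The points 1/(k+2) are infinitely many roots. *)
Lemma poly_eq0_disc (p : {poly C}) : (forall z, `|z| < 1 -> p.[z] = 0) -> p = 0.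
Proof.
move=> h; apply/eqP; apply: contraT => p0.
pose x (k : nat) : C := (k.+2%:R)^-1.
have xi : injective x.
  by move=> i j /invr_inj /eqP; rewrite eqr_nat => /eqP [].
have := max_poly_roots p0 (_ : all (root p) [seq x k | k <- iota 0 (size p)]) _.
rewrite size_map size_iota ltnn => -> //.
  apply/allP => _ /mapP[k _ ->]; apply/rootP; apply: h.
  by rewrite normfV normr_nat invf_lt1 ?ltr0n// ltr1n.
by rewrite map_inj_uniq ?iota_uniq.
Qed.

Lemma ratfun_eq_disc (f : rat) (p q : {poly C}) :
  (forall z, `|z| < 1 -> q.[z] != 0) ->
  (forall z, `|z| < 1 -> feval f z = p.[z] / q.[z]) -> f = tofrac p / tofrac q.
Proof.
move=> hq h; have q0 : q != 0.
  by apply: contraNneq (hq 0 _) => [->|]; rewrite ?horner0 ?normr0.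
have d0 := denom_neq0 f.
rewrite -[f in LHS]numden; apply/eqP; rewrite eqr_div ?tofrac_eq0// -!rmorphM tofrac_eq.
rewrite -subr_eq0 -(mulIr_eq0 _ (mulIf d0)); apply/eqP; apply: poly_eq0_disc => z hz.
rewrite hornerM; have [->|dz] := eqVneq (denom f).[z] 0; first by rewrite mulr0.
have := h z hz; rewrite -{1}(numden f) feval_frac// => /eqP.
rewrite eqr_div ?hq// => /eqP e.
by rewrite hornerD hornerN !hornerM e subrr mul0r.
Qed.

Lemma ratspace_seqP s (f : rat) : ratspace_seq s f ->
  exists2 p : {poly C}, (size p <= (size s).+1)%N & f = tofrac p / tofrac (den_poly s).
Proof. by case=> p hp ->; exists p; rewrite ?tofrac_den. Qed.

Lemma size_points (be : nat -> C) n : size (points be n) = n.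
Proof. by rewrite size_map size_iota. Qed.

(** The zeros of zeta_0 B_{n-1}. *)
Definition zero_points (be : nat -> C) n : seq C := [seq be j | j <- iota 0 n].

Lemma zero_points_cat (be : nat -> C) n :
  zero_points be n ++ [:: be n] = be 0%N :: points be n.
Proof.
transitivity [seq be j | j <- iota 0 n.+1]; last by [].
by rewrite -addn1 iotaD map_cat.
Qed.

Lemma points_rcons (be : nat -> C) n : points be n.+1 = points be n ++ [:: be n.+1].
Proof. by rewrite /points -[in LHS](addn1 n) iotaD map_cat. Qed.

Lemma Bl_points (be : nat -> C) n : Bl be n = \prod_(b <- points be n) zeta b.
Proof.
rewrite BlE big_map; have -> : iota 1 n = index_iota 1 n.+1 by rewrite /index_iota subn1.
by rewrite big_add1.
Qed.

Lemma zeta_Bpred_zero_points (be : nat -> C) n :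
  zeta (be 0%N) * Bpred be n = \prod_(b <- zero_points be n) zeta b.
Proof. by rewrite zeta_BpredE big_map /index_iota subn0. Qed.

Lemma in_disc_map (be : nat -> C) t :
  (forall j, j \in t -> `|be j| < 1) -> in_disc [seq be j | j <- t].
Proof. by move=> h x /mapP[j jt ->]; exact: h. Qed.

Section OneFunction.
Variables (be : nat -> C) (F : C -> C) (mu : probability (borelC R) R) (N : nat).
Hypothesis hbe : forall j, (j <= N)%N -> `|be j| < 1.
Hypothesis hmu : represents mu (be 0%N) F.
Variables phi psi : rat.
Hypotheses (hphi : ratspace be N phi)
  (horth : forall f, ratspace_pred be N f -> orthogonal_LF mu phi f)
  (hpsi : second_kind mu (be 0%N) phi psi).

Lemma ratspace_disc : in_disc (points be N).
Proof. by apply: in_disc_map => j; rewrite mem_iota add1n ltnS => /andP[_ /hbe]. Qed.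

(** The functions phi F + psi and phi^* F - psi^*, cleared of denominators, vanish
    at beta_0, ..., beta_{N-1} with multiplicities. For N = 0 there is no such
    point, and no orthogonality condition either. *)
Lemma orthogonal_pair : exists p q : {poly C},
  [/\ (size p <= N.+1)%N /\ (size q <= N.+1)%N,
      phi = tofrac p / tofrac (den_poly (points be N)),
      psi = tofrac q / tofrac (den_poly (points be N)),
      forall x, x \in zero_points be N ->
        dominated x (horner (zeros_poly (zero_points be N))) (fun z => p.[z] * F z + q.[z])
    & forall x, x \in zero_points be N ->
        dominated x (horner (zeros_poly (zero_points be N)))
          (fun z => (reversal N p).[z] * F z - (reversal N q).[z])].
Proof.
have [mu1 hF] := hmu; have hs := ratspace_disc; have hb := hbe (leq0n N).
have [p hp phiE] := ratspace_seqP hphi.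
have [q hq qE] := second_kind_poly hb mu1 hs hp.
set s := points be N in hs hp phiE hq qE *.
have phi_val z : `|z| <= 1 -> feval phi z = p.[z] / (den_poly s).[z].
  by move=> hz; rewrite phiE feval_frac// den_horner_neq0.
have LE : LF mu phi = cintegral mu (fun t => p.[t] / (den_poly s).[t]).
  by apply: eq_cintegral => t ht; rewrite phi_val// ht.
have psiE : psi = tofrac q / tofrac (den_poly s).
  apply: ratfun_eq_disc => z hz; first by rewrite den_horner_neq0// ltW.
  have dz : (den_poly s).[z] != 0 by rewrite den_horner_neq0// ltW.
  have z1 : `|z| != 1 by rewrite lt_eqF.
  rewrite hpsi// qE// -LE mulrDl mulfK//; congr (_ + _).
  rewrite mulrC -cintegralZ; last first.
    apply: circle_funM; first exact: circle_fun_herglotz.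
    apply: circle_funD; last exact: circle_fun_cst.
    apply: circle_funM; last exact: circle_fun_cst.
    by apply: circle_funM; [exact: circle_fun_horner|exact: circle_fun_inv_den].
  apply: eq_cintegral => t ht.
  rewrite kerDE// !phi_val ?ht ?(ltW hz)//.
  by move: (p.[t] / _) => y; field.
have sN : size s = N by exact: size_points.
exists p, q; rewrite sN in hp hq.
have [N0|N0] := posnP N.
  by split=> //; rewrite N0.
pose n := N.-1; have NE : N = n.+1 by rewrite prednK.
pose s1 := points be n.
have s1n : size s1 = n by exact: size_points.
have sE : s = s1 ++ [:: be N] by rewrite /s NE points_rcons.
have zE : zero_points be N = be 0%N :: s1 by rewrite NE.
have hs1 : in_disc s1 by move=> x xs1; apply: hs; rewrite sE mem_cat xs1.
have orth (u : {poly C}) : (size u <= (size s1).+1)%N ->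
    cintegral mu (fun t => p.[t] / (den_poly s).[t] * (u.[t] / (zeros_poly s1).[t])) = 0.
  move=> hu; pose f := tofrac (reversal (size s1) u) / tofrac (den_poly s1).
  have fL : ratspace_pred be N f.
    rewrite NE; exists (reversal (size s1) u); first exact: size_reversal.
    by rewrite /f tofrac_den.
  have fS : substar f = tofrac u / tofrac (zeros_poly s1).
    by rewrite /f (substar_reversal (size_reversal _ _) (size_den s1) (den_neq0 s1));
      rewrite reversalK// reversal_den.
  rewrite -[RHS](horth fL) /LF fS phiE mulf_div -!rmorphM.
  apply: eq_cintegral => t ht.
  have d0 : (den_poly s).[t] != 0 by rewrite den_horner_neq0// ht.
  have z0 : (zeros_poly s1).[t] != 0 by rewrite zer_horner_neq0// ht.
  by rewrite feval_frac hornerM ?mulf_neq0// hornerM mulf_div.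
have L0 : cintegral mu (fun t => p.[t] / (den_poly s).[t]) = 0.
  rewrite -[RHS](orth (zeros_poly s1)) ?size_zer//; apply: eq_cintegral => t ht.
  by rewrite divff ?mulr1// zer_horner_neq0// ht.
have qE' w : `|w| != 1 -> q.[w] =
    cintegral mu (fun t =>
      herglotz (be 0%N) t w * (p.[t] / (den_poly s).[t] * (den_poly s).[w] - p.[w])).
  by move=> hw; rewrite qE// L0 mul0r addr0.
have z1 x : x \in zero_points be N -> `|x| < 1.
  by case/mapP => j; rewrite mem_iota add0n => /andP[_ jN] ->; apply: hbe; exact: ltnW.
rewrite sE in orth qE'.
split=> // x /z1 x1; rewrite zE.
- exact: (dominated_remainder mu1 hb (hbe (leqnn N)) hs1 hF orth qE' x1).
- rewrite -{1 2}sN sE.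
  apply: (dominated_reversed mu1 hb (hbe (leqnn N)) hs1 hF _ _ orth qE' x1);
    by rewrite -sE sN.
Qed.

End OneFunction.
End Assembly.

(** * Divisibility of the transformed pair *)

(** The relations say that beta_0, ..., beta_{N-1} followed by beta_N is beta_0
    followed by beta_1, ..., beta_N. *)
Lemma PN_cancel (K : fieldType) (k e w0 w0s wN wNs z z' d d' : K) :
    wN != 0 -> wNs != 0 -> d != 0 -> z' * wNs = w0s * z -> d' * wN = w0 * d ->
  k * (w0 * w0s) / (wN * wNs) * (e * z / d) = k * e * (z' * d') / d ^+ 2.
Proof.
move=> h1 h2 h3 e1 e2.
have -> : z' = w0s * z / wNs by rewrite -e1 mulfK.
have -> : d' = w0 * d / wN by rewrite -e2 mulfK.
by field; rewrite h1 h2 h3.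
Qed.

Lemma cancel_zeros (K : fieldType) (p a q b zs ds w d dt c k : K) :
    zs != 0 -> ds != 0 -> d != 0 -> dt != 0 -> c != 0 -> k != 0 ->
    p * a + q * b = zs * ds * w ->
  (p / d * (a / (d * dt)) + q / d * (b / (d * dt))) / (c * (k * (zs * ds) / d ^+ 2)) =
  (c * k)^-1 * w / dt.
Proof.
move=> h1 h2 h3 h4 h5 h6 e.
have -> : p / d * (a / (d * dt)) + q / d * (b / (d * dt)) =
    (p * a + q * b) / (d ^+ 2 * dt) by field; rewrite h3 h4.
by rewrite e; field; rewrite h1 h2 h3 h4 h5 h6.
Qed.

Section Division.
Variable R : realType.
Local Notation C := R[i].
Local Notation rat := (ratfun R).
Local Notation cst := (@ratcst R).

Lemma holomorphic_bounded (g : C -> C) x : holomorphic_disc g -> `|x| < 1 -> bounded_near x g.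
Proof.
move=> hg hx; apply: bounded_near_continuous.
by have /derivable1_diffP/differentiable_continuous := hg x hx.
Qed.

Lemma dominated_blaschke s (h g : C -> C) (k : {poly C}) : in_disc s -> holomorphic_disc g ->
    (forall z, `|z| < 1 -> (den_poly s).[z] * h z = (zeros_poly s).[z] * (k.[z] * g z)) ->
  forall x, x \in s -> dominated x (horner (zeros_poly s)) (fun z => (den_poly s).[z] * h z).
Proof.
move=> hs hg hh x xs; have hx := hs x xs.
have bk : bounded_near x (fun z => k.[z] * g z).
  by apply: bounded_nearM; [exact: bounded_near_horner|exact: holomorphic_bounded].
apply: dominated_near (dominated_mul _ bk); apply: filterS (near_disc hx) => z hz.
by rewrite hh// mulrC.
Qed.

Lemma dvdp_zeros_den s (p : {poly C}) :
  in_disc s -> zeros_poly s %| den_poly s * p -> zeros_poly s %| p.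
Proof.
move=> hs; rewrite Gauss_dvdpr//; apply: coprime_zer => x xs.
by apply: den_horner_neq0 => //; apply: ltW; exact: hs.
Qed.

(** p a + q b = b (p F + q) + p (a - b F), up to the factor den_poly s. *)
Lemma dvdp_pencil s (F : C -> C) (p q a b : {poly C}) : in_disc s ->
    (forall x, x \in s -> dominated x (horner (zeros_poly s)) (fun z => p.[z] * F z + q.[z])) ->
    (forall x, x \in s ->
      dominated x (horner (zeros_poly s)) (fun z => (den_poly s).[z] * (a.[z] - b.[z] * F z))) ->
  zeros_poly s %| p * a + q * b.
Proof.
move=> hs h1 h2; apply: dvdp_zeros_den => //; apply: dvdp_dominated => x xs.
have b1 := bounded_near_horner x (den_poly s * b); have b2 := bounded_near_horner x p.
have := dominatedD (dominatedM b1 (h1 x xs)) (dominatedM b2 (h2 x xs)).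
apply: dominated_near; apply: nearW => z.
by rewrite !(hornerM, hornerD); ring.
Qed.

(** b (p c + q d) = d (p a + q b) - p (a d - b c), and b is prime to zeros_poly s. *)
Lemma dvdp_pencil_dual s (p q a b c d : {poly C}) :
    (forall x, x \in s -> b.[x] != 0) ->
    zeros_poly s %| a * d - b * c -> zeros_poly s %| p * a + q * b ->
  zeros_poly s %| p * c + q * d.
Proof.
move=> hb h1 h2; rewrite -(@Gauss_dvdpr _ _ b); last exact: coprime_zer.
have -> : b * (p * c + q * d) = d * (p * a + q * b) - p * (a * d - b * c) by ring.
by rewrite dvdp_sub// dvdp_mull.
Qed.

(** P_N shifts the index of half of the zeros and poles of B_N, so that P_N B_N
    vanishes at beta_0, ..., beta_{N-1} and at their reflections. *)
Lemma PN_BlE (be : nat -> C) N : (forall j, (j <= N)%N -> `|be j| < 1) ->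
  exists2 k : C, k != 0 & PN (be 0%N) (be N) * Bl be N =
    cst k * tofrac (zeros_poly (zero_points be N) * den_poly (zero_points be N))
      / tofrac (den_poly (points be N)) ^+ 2.
Proof.
move=> hbe; have hv j : (j <= N)%N -> (varpi_poly (be j)).[be j] != 0.
  by move=> /hbe h; rewrite horner_varpi_neq0// ltW.
exists ((varpi_poly (be N)).[be N] / (varpi_poly (be 0%N)).[be 0%N] * eta_prod (points be N)).
  by rewrite !mulf_neq0 ?invr_eq0 ?hv ?eta_prod_neq0.
have e1 : tofrac (zeros_poly (zero_points be N)) * varpi_star (be N) =
    varpi_star (be 0%N) * tofrac (zeros_poly (points be N)).
  rewrite /varpi_star -!rmorphM /= -zer_cons -zero_points_cat zeros_poly_cat.
  by rewrite [zeros_poly [:: _]]big_seq1.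
have e2 : tofrac (den_poly (zero_points be N)) * varpi (be N) =
    varpi (be 0%N) * tofrac (den_poly (points be N)).
  rewrite /varpi -!rmorphM /= -den_cons -zero_points_cat den_cat.
  by rewrite [den_poly [:: _]]big_seq1.
rewrite Bl_points prod_zetaE /PN -mul_polyC [tofrac (_ * zeros_poly _)]rmorphM /=.
have d0 : tofrac (den_poly (points be N)) != 0 by rewrite tofrac_eq0 den_neq0.
rewrite [cst (_ * eta_prod _)]rmorphM [tofrac (zeros_poly _ * _)]rmorphM /=.
exact: (PN_cancel _ _ (varpi_neq0 (be N)) (varpi_star_neq0 (be N)) d0 e1 e2).
Qed.

Lemma initial_in_space (be betat : nat -> C) N r (c k tau : C) (phi psi A B : rat)
    (p q a b : {poly C}) :
    (forall j, (j <= N)%N -> `|be j| < 1) -> c != 0 -> k != 0 ->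
    (size p <= N.+1)%N -> (size q <= N.+1)%N ->
    (size a <= (N + r).+1)%N -> (size b <= (N + r).+1)%N ->
    k *: reversal (N + r) a = tau *: a -> k *: reversal (N + r) b = - tau *: b ->
    zeros_poly (zero_points be N) %| p * a + q * b ->
    zeros_poly (zero_points be N) %| reversal N p * a - reversal N q * b ->
    phi = tofrac p / tofrac (den_poly (points be N)) ->
    psi = tofrac q / tofrac (den_poly (points be N)) ->
    A = tofrac a / tofrac (den_poly (points be N ++ points betat r)) ->
    B = tofrac b / tofrac (den_poly (points be N ++ points betat r)) ->
  ratspace betat r ((phi * A + psi * B) / (cst c * PN (be 0%N) (be N) * Bl be N)).
Proof.
move=> hbe c0 k0 hp hq ha hb ra rb d1 d2 -> -> -> ->.
have sz : size (zero_points be N) = N by rewrite size_map size_iota.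
have hz : in_disc (zero_points be N).
  by apply: in_disc_map => j; rewrite mem_iota add0n => /andP[_ /ltnW/hbe].
have := @pencil_factorization R (zero_points be N) r p q a b k tau hz; rewrite /= sz.
move=> /(_ hp hq ha hb k0 ra rb d1 d2) [w hw e].
have [k' k'0 eP] := PN_BlE hbe.
exists ((c * k')^-1 *: w); first by rewrite size_points (leq_trans (size_scale_leq _ _)).
have eW : tofrac ((c * k')^-1 *: w) = (cst c * cst k')^-1 * tofrac w.
  by rewrite -mul_polyC rmorphM /= -ratcstM -ratcstV.
have eS : tofrac (den_poly (points be N ++ points betat r)) =
    tofrac (den_poly (points be N)) * tofrac (den_poly (points betat r)) by rewrite den_cat rmorphM.
have eZ : tofrac (zeros_poly (zero_points be N) * den_poly (zero_points be N)) =
    tofrac (zeros_poly (zero_points be N)) *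
    tofrac (den_poly (zero_points be N)) by rewrite rmorphM.
rewrite -mulrA eP -tofrac_den eW eS eZ.
have e' := congr1 (@FracField.tofrac {poly C}) e; rewrite rmorphD !rmorphM /= in e'.
have nz (x : {poly C}) : x != 0 -> tofrac x != 0 by rewrite tofrac_eq0.
apply: (cancel_zeros _ _ _ _ _ _ e');
  by rewrite ?ratcst_eq0// nz// ?zer_neq0 ?den_neq0.
Qed.

End Division.

(** * The transformed recurrence *)

(** In a field 0 / 0 = 0, so a nonzero quotient X^* / X forces X to be nonzero. *)
Lemma eigen_nonzero (R : realType) (BB X : ratfun R) (t : R[i]) : t != 0 ->
  superstar BB X / X = ratcst t -> superstar BB X = ratcst t * X.
Proof.
move=> t0 e; have X0 : X != 0.
  apply: contraTneq t0 => X0; rewrite negbK -(ratcst_eq0 t).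
  by rewrite -e X0 invr0 mulr0.
by rewrite -e mulfVK.
Qed.

Lemma clear_denominators (K : fieldType) (n D e z s g : K) : D != 0 -> s != 0 ->
  n / D = e * z / s * g -> s * n = z * (e * D * g).
Proof.
move=> D0 s0 h; have -> : n = e * z / s * g * D by rewrite -h mulfVK.
by field; rewrite s0.
Qed.

Lemma clear_denominators_pencil (K : fieldType) (a b F D e z s g : K) :
    D != 0 -> s != 0 ->
  a / D - b / D * F = e * z / s * g -> s * (a - b * F) = z * (e * D * g).
Proof.
move=> D0 s0 h; apply: clear_denominators => //.
by rewrite -h mulrBl mulrAC.
Qed.

Theorem corollary9 (R : realType) (N r : nat)
  (* beta_0..beta_N, betah_0, betah_1, ... and betat_0..betat_r *)
  (beta betah betat : nat -> R[i])
  (hbeta : forall j, (j <= N)%N -> `|beta j| < 1)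
  (hbetah : forall j, `|betah j| < 1)
  (hbetat : forall j, (j <= r)%N -> `|betat j| < 1)
  (hbetah0 : betah 0%N = beta N)
  (be : nat -> R[i]) (hbe : be = continued N beta betah)
  (F : R[i] -> R[i]) (hF : C_function F) (hF1 : F (be 0%N) = 1)
  (mu : probability (borelC R) R) (hmu : represents mu (be 0%N) F)
  (hpos : positive_definite mu be)
  (phi psi : nat -> ratfun R)
  (hphiL : forall n, ratspace be (N + n) (phi (N + n)%N))
  (hphi0 : forall n, phi (N + n)%N != 0)
  (hphiO : forall n f, ratspace_pred be (N + n) f ->
     orthogonal_LF mu (phi (N + n)%N) f)
  (hpsi : forall n, second_kind mu (be 0%N) (phi (N + n)%N) (psi (N + n)%N))
  (lam rho : nat -> R[i]) (e : nat -> R)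
  (hlam : forall n, (0 < n)%N -> `|lam (N + n)%N| < 1)
  (hrho : forall n, (0 < n)%N -> `|rho (N + n)%N| = 1)
  (he : forall n, (0 < n)%N -> e (N + n)%N != 0)
  (hrec : forall n, (0 < n)%N ->
     pair_mx (Bl be (N + n)) (phi (N + n)%N) (psi (N + n)%N) =
       umx be (N + n) (e (N + n)%N) (rho (N + n)%N)
       *m szego_mx (lam (N + n)%N)
       *m zeta_mx (be (N + n.-1)%N)
       *m pair_mx (Bl be (N + n.-1)) (phi (N + n.-1)%N) (psi (N + n.-1)%N))
  (A B C D : ratfun R) (BB : ratfun R) (hBB : BB = Bl be N * Bl betat r)
  (hA : ratspace_mul be N betat r A) (hB : ratspace_mul be N betat r B)
  (hC : ratspace_mul be N betat r C) (hD : ratspace_mul be N betat r D)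
  (sA : self_reciprocal BB A) (sB : self_reciprocal BB B)
  (sC : self_reciprocal BB C) (sD : self_reciprocal BB D)
  (tau : R[i]) (htau : `|tau| = 1)
  (tA : superstar BB A / A = ratcst tau)
  (tB : - (superstar BB B / B) = ratcst tau)
  (tC : - (superstar BB C / C) = ratcst tau)
  (tD : superstar BB D / D = ratcst tau)
  (hBnz : forall j, (j < N)%N -> feval B (be j) != 0)
  (g : R[i] -> R[i]) (hg : holomorphic_disc g)
  (hABF : forall z : R[i], `|z| < 1 ->
     feval A z - feval B z * F z
     = feval (zeta (be 0%N) * Bpred be N) z * g z)
  (f : R[i] -> R[i]) (hf : holomorphic_disc f)
  (hADBC : forall z : R[i], `|z| < 1 ->
     feval (A * D - B * C) z = feval (zeta (be 0%N) * Bpred be N) z * f z)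
  (c : nat -> R) (hc : forall n, c n != 0)
  (G J : nat -> ratfun R)
  (hG : forall n, G (r + n)%N =
     (phi (N + n)%N * A + psi (N + n)%N * B)
     / (ratcst (real_complex R (c n)) * PN (be 0%N) (be N) * Bl be N))
  (hJ : forall n, J (r + n)%N =
     (phi (N + n)%N * C + psi (N + n)%N * D)
     / (ratcst (real_complex R (c n)) * PN (be 0%N) (be N) * Bl be N)) :
  (forall n, (0 < n)%N ->
     pair_mx (Bl betat r * Bl betah n) (G (r + n)%N) (J (r + n)%N) =
       (ratcst (real_complex R (c n.-1 / c n))
          *: umx be (N + n) (e (N + n)%N) (rho (N + n)%N))
       *m szego_mx (tau * lam (N + n)%N)
       *m zeta_mx (betah n.-1)
       *m pair_mx (Bl betat r * Bl betah n.-1)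
                  (G (r + n.-1)%N) (J (r + n.-1)%N)
     /\ zeta (be (N + n.-1)%N) = zeta (betah n.-1))
  /\ ratspace betat r (G r) /\ ratspace betat r (J r).
Proof.
have tau0 : tau != 0 by rewrite -normr_eq0 htau oner_eq0.
have hbe1 j : (j <= N)%N -> be j = beta j by rewrite hbe /continued => ->.
have disc j : (j <= N)%N -> `|be j| < 1 by move=> jN; rewrite hbe1// hbeta.
have BlN m : Bl be (N + m) = Bl be N * Bl betah m by rewrite hbe Bl_cat.
have zetaN m : zeta (be (N + m)%N) = zeta (betah m).
  rewrite hbe /continued; case: m => [|m]; first by rewrite addn0 leqnn hbetah0.
  by rewrite leqNgt addnS ltnS leq_addr /= -addnS addKn.
have BBE : BB = \prod_(x <- points be N ++ points betat r) zeta x.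
  by rewrite hBB big_cat -!Bl_points.
have sA' : superstar BB A = ratcst tau * A by exact: eigen_nonzero.
have sD' : superstar BB D = ratcst tau * D by exact: eigen_nonzero.
have sB' : superstar BB B = ratcst (- tau) * B.
  by apply: eigen_nonzero; rewrite ?oppr_eq0// ratcstN -tB opprK.
have sC' : superstar BB C = ratcst (- tau) * C.
  by apply: eigen_nonzero; rewrite ?oppr_eq0// ratcstN -tC opprK.
have Bt0 : Bl betat r != 0 by exact: Bpred_neq0.
have BN0 : Bl be N != 0 by exact: Bpred_neq0.
split=> [n n0|].
  have KE m : pair_mx (Bl betat r * Bl betah m) (G (r + m)%N) (J (r + m)%N) =
      (ratcst (real_complex R (c m)) * (PN (be 0%N) (be N) * Bl be N))^-1 *:
      (mat2 1 0 0 (ratcst tau) *m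
       pair_mx (Bl be (N + m)) (phi (N + m)%N) (psi (N + m)%N) *m mat2 A C B D).
    rewrite hG hJ BlN mulrA; apply: pair_mx_transform => //.
    - exact: substar_PN.
    - exact: substar_Bl.
    - by rewrite -hBB.
    - by rewrite -hBB sB' ratcstN mulNr.
    - by rewrite -hBB sC' ratcstN mulNr.
    - by rewrite -hBB.
  split; last exact: zetaN.
  have -> : zeta_mx (betah n.-1) = zeta_mx (be (N + n.-1)%N) by rewrite /zeta_mx zetaN.
  rewrite !KE; apply: recurrence_transform => //; last exact: hrec.
  exact: umx_diag.
(* G_r and J_r: S lists the poles of L_N * Lt_r, and s' = beta_0, ..., beta_{N-1} are
   the zeros to be cancelled. *)
set S := points be N ++ points betat r in BBE.
have sS : size S = (N + r)%N by rewrite size_cat !size_points.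
have hS : in_disc S.
  move=> x; rewrite mem_cat => /orP[]; first exact: ratspace_disc.
  by move: x; apply: in_disc_map => j; rewrite mem_iota add1n ltnS => /andP[_ /hbetat].
have [p [q [[hp hq] pE qE dom1 dom2]]] : exists p q : {poly R[i]},
  [/\ (size p <= N.+1)%N /\ (size q <= N.+1)%N,
      phi N = tofrac p / tofrac (den_poly (points be N)),
      psi N = tofrac q / tofrac (den_poly (points be N)),
      forall x, x \in zero_points be N ->
        dominated x (horner (zeros_poly (zero_points be N))) (fun z => p.[z] * F z + q.[z])
    & forall x, x \in zero_points be N ->
        dominated x (horner (zeros_poly (zero_points be N)))
          (fun z => (reversal N p).[z] * F z - (reversal N q).[z])].
  apply: (orthogonal_pair disc hmu).
  - by have := hphiL 0%N; rewrite addn0.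
  - by have := hphiO 0%N; rewrite addn0.
  - by have := hpsi 0%N; rewrite addn0.
set s' := zero_points be N in dom1 dom2.
have hs' : in_disc s'.
  by apply: in_disc_map => j; rewrite mem_iota add0n => /andP[_ /ltnW/disc].
have [hA' hB' hC' hD'] : [/\ ratspace_seq S A, ratspace_seq S B, ratspace_seq S C
    & ratspace_seq S D] by split; [exact: hA|exact: hB|exact: hC|exact: hD].
have [a ha aE] := ratspace_seqP hA'; have [b hb bE] := ratspace_seqP hB'.
have [c1 hc1 cE] := ratspace_seqP hC'; have [d hd dE] := ratspace_seqP hD'.
have k0 := eta_prod_neq0 S.
have ra : eta_prod S *: reversal (N + r) a = tau *: a.
  by rewrite -sS; apply: superstar_eigen; rewrite // -BBE -aE.
have rb : eta_prod S *: reversal (N + r) b = - tau *: b.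
  by rewrite -sS; apply: superstar_eigen; rewrite // -BBE -bE.
(* C, D form a pencil of the same type as A, B, with eigenvalues - tau and - - tau. *)
have rc : eta_prod S *: reversal (N + r) c1 = - tau *: c1.
  by rewrite -sS; apply: superstar_eigen; rewrite // -BBE -cE.
have rd : eta_prod S *: reversal (N + r) d = - - tau *: d.
  by rewrite opprK -sS; apply: superstar_eigen; rewrite // -BBE -dE.
rewrite sS in ha hb hc1 hd.
have dS z : `|z| < 1 -> (den_poly S).[z] != 0 by move=> hz; rewrite den_horner_neq0// ltW.
have ds z : `|z| < 1 -> (den_poly s').[z] != 0 by move=> hz; rewrite den_horner_neq0// ltW.
have zB z : `|z| < 1 -> feval (zeta (be 0%N) * Bpred be N) z =
    eta_prod s' * (zeros_poly s').[z] / (den_poly s').[z].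
  by move=> hz; rewrite zeta_Bpred_zero_points prod_zetaE feval_frac ?ds// hornerZ.
have dom3 x : x \in s' -> dominated x (horner (zeros_poly s'))
    (fun z => (den_poly s').[z] * (a.[z] - b.[z] * F z)).
  move: x; apply: (dominated_blaschke (k := eta_prod s' *: den_poly S) hs' hg) => z hz.
  have := hABF z hz; rewrite zB// aE bE !feval_frac ?dS//.
  rewrite hornerZ; apply: clear_denominators_pencil; [exact: dS|exact: ds].
(* A D - B C has the denominator of A squared; on the disc it is a unit, and so is
   the denominator of the Blaschke product. *)
have adbc : zeros_poly s' %| a * d - b * c1.
  apply: dvdp_zeros_den => //; apply: dvdp_dominated => x xs.
  have h : forall z, `|z| < 1 -> (den_poly s').[z] * (a * d - b * c1).[z] =
      (zeros_poly s').[z] * ((eta_prod s' *: (den_poly S * den_poly S)).[z] * f z).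
    move=> z hz; have := hADBC z hz; rewrite zB//.
    have -> : A * D - B * C = tofrac (a * d - b * c1) / tofrac (den_poly S * den_poly S).
      by rewrite aE bE cE dE !mulf_div -mulrBl !(rmorphB, rmorphM).
    rewrite feval_frac hornerM ?mulf_neq0 ?dS// hornerZ hornerM.
    by apply: clear_denominators; [rewrite mulf_neq0 ?dS|exact: ds].
  have := dominated_blaschke hs' hf h xs.
  by apply: dominated_near; apply: nearW => z; rewrite hornerM.
have b0 x : x \in s' -> b.[x] != 0.
  move=> xs; have x1 := hs' x xs; case/mapP: xs => j.
  rewrite mem_iota add0n => /andP[_ jN] xE; rewrite xE in x1 *.
  apply: contraNneq (hBnz j jN) => bx.
  by rewrite bE feval_frac ?dS// bx mul0r.
have dvd1 : zeros_poly s' %| p * a + q * b by exact: (dvdp_pencil hs' dom1 dom3).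
(* The reflected remainder is of the same form, with the reversals of p and - q. *)
have dom2' x : x \in s' -> dominated x (horner (zeros_poly s'))
    (fun z => (reversal N p).[z] * F z + (- reversal N q).[z]).
  by move=> xs; apply: dominated_near (dom2 x xs); apply: nearW => z; rewrite hornerN.
have dvd2 : zeros_poly s' %| reversal N p * a + (- reversal N q) * b.
  exact: (dvdp_pencil hs' dom2' dom3).
have dvd3 := dvdp_pencil_dual b0 adbc dvd1.
have dvd4 := dvdp_pencil_dual b0 adbc dvd2.
rewrite mulNr in dvd2; rewrite mulNr in dvd4.
have c0 : (real_complex R (c 0%N)) != 0.
  by rewrite -(rmorph0 (real_complex R)) (inj_eq (@complexI R)).
split.
- have := hG 0%N; rewrite !addn0 => ->.
  exact: (initial_in_space disc c0 k0 hp hq ha hb ra rb dvd1 dvd2 pE qE aE bE).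
- have := hJ 0%N; rewrite !addn0 => ->.
  exact: (initial_in_space disc c0 k0 hp hq hc1 hd rc rd dvd3 dvd4 pE qE cE dE).
Qed.
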